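(* Let $\phi(z)=1-|\Re(z)|$ on $\mathbb{D}$ and let $1\le p<\infty$. (i) There exists a constant $C_p>0$ such that, for all $f\in A^p_\phi$, $$|f(z)|\le\frac{C_p}{(1-|z|)^{\frac2p}(1-|\Re(z)|)^{\frac1p}}\|f\|_{A^p_\phi},\qquad z\in\mathbb{D}.$$ (ii) There exists a constant $C_p'>0$ such that, for all $f\in A^p_\phi$ and all $n\ge0$, $$\frac{|f^{(n)}(0)|}{n!}\le C_p'(n+1)^{\frac3p}\|f\|_{A^p_\phi}.$$
   Context: $\mathbb{D}$ is the open unit disc in $\mathbb{C}$ and $dA=\frac1\pi dx\,dy$. $A^p_\phi$ is the space of analytic $f$ on $\mathbb{D}$ with $\|f\|^p_{A^p_\phi}=\int_{\mathbb{D}}|f|^p\phi\,dA<\infty$. *)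

(* Defs.v *)
From HB Require Import structures.
From mathcomp Require Export all_boot all_order all_algebra.
From mathcomp Require Export complex.
From mathcomp Require Export all_classical all_reals all_analysis.
Export Order.TTheory GRing.Theory Num.Theory.
Export numFieldNormedType.Exports.

Set Implicit Arguments.
Unset Strict Implicit.
Unset Printing Implicit Defensive.

Local Open Scope classical_set_scope.
Local Open Scope complex_scope.
Local Open Scope ring_scope.

(* The generic norm `|z| of R[i] takes its values in R[i]; this is the modulus
   as an element of R. *)
Notation cabs := ComplexField.Normc.normc.

Definition unit_disc {R : realType} : set R[i] := [set z | cabs z < 1].

(* R[i]^o is R[i] as a normed module over itself, so derivability along 1 is
   complex differentiability. *)
Definition analytic_on_disc {R : realType} (f : R[i] -> R[i]) : Prop :=
  forall z, unit_disc z -> @derivable R[i] R[i]^o R[i]^o f z 1.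

(* The n-th complex derivative; junk value where f is not n times
   differentiable. *)
Definition cderiven {R : realType} (n : nat) (f : R[i] -> R[i]) : R[i] -> R[i] :=
  @derive1n R[i] R[i]^o n f.

(* dA = dx dy / pi, with R[i] identified with R * R. *)
Definition disc_integral {R : realType} (g : R[i] -> R) : \bar R :=
  ((pi^-1)%:E *
   \int[lebesgue_measure \x lebesgue_measure]_(u in
       [set u : R * R | unit_disc (u.1 +i* u.2)]) (g (u.1 +i* u.2))%:E)%E.

Definition bergman_integral {R : realType} (phi : R[i] -> R) (p : R)
    (f : R[i] -> R[i]) : \bar R :=
  disc_integral (fun z => cabs (f z) `^ p * phi z).

Definition bergman_space {R : realType} (phi : R[i] -> R) (p : R)
    : set (R[i] -> R[i]) :=
  [set f | analytic_on_disc f /\ (bergman_integral phi p f < +oo)%E].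

Definition bergman_norm {R : realType} (phi : R[i] -> R) (p : R)
    (f : R[i] -> R[i]) : R :=
  fine (bergman_integral phi p f) `^ p^-1.

Definition phi_weight {R : realType} (z : R[i]) : R := 1 - `|complex.Re z|.

(* Main.v *)
Require Import Defs.
From mathcomp Require Import all_boot all_order all_algebra.
From mathcomp Require Import complex.
From mathcomp Require Import all_classical all_reals all_analysis.
From mathcomp Require Import measurable_realfun ring lra zify.
Import Order.TTheory GRing.Theory Num.Theory.
Import numFieldNormedType.Exports.

(* Goursat's lemma on rectangles, proved by bisection, needs no continuity of
   the derivative. Splitting a small square off around z turns it into Cauchy's
   formula
     f z * \oint dw / (w - z) = \oint f w dw / (w - z)
   on rectangles, and differentiating the two Cauchy integrals shows that f' is
   again holomorphic.

   (i) Averaging Cauchy's formula over rectangles of size comparable to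
   r = (1 - |z|) / 4 gives r^2 |f z| <= 16 \int_Q |f| for the square Q of centre
   z and half side r; on Q the weight is at least half its value at z. The
   exponent p enters through the inequality t <= s + s (t / s)^p, integrated
   over Q with s a small multiple of |f z|, which replaces Hoelder's inequality.

   (ii) Goursat's lemma in the coordinate w = log z is the mean value property
   on circles. Writing a_n(f) for the integral of f (r e^it) e^(-int) over a
   period, integration by parts gives r a_n(f') = (n + 1) a_(n+1)(f), so that
   2 pi r^n f^(n)(0) = n! a_n(f). This is Cauchy's estimate, and (i) on the circle
   of radius r = (n + 1) / (n + 2) concludes, since r^(-n) <= e. *)

Set Implicit Arguments.
Unset Strict Implicit.
Unset Printing Implicit Defensive.

Local Open Scope classical_set_scope.
Local Open Scope complex_scope.
Local Open Scope ring_scope.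

(** * The modulus of complex numbers *)

Section ComplexModulus.
Context {R : realType}.
Implicit Types (x y : R) (z w : R[i]).

(** Rectangles are preferred to discs because every contour integral then splits into integrals of
    one real variable along the axes, and averaging over sides becomes Tonelli's theorem for the
    product measure, with no polar coordinates. The price is the integral of 1 / (w - z) along a
    rectangle, whose exact value is never computed. Two facts suffice: it does not vanish, so that f
    is a quotient of two Cauchy integrals, and its imaginary part is at least 1 when the sides lie
    between distance r/2 and r from the centre, because all four sides contribute with the same
    sign.

    Holomorphy of f' serves (ii): the induction on n passes from f to f', and integration by parts
    needs f' to be continuous. Circles and radii become vertical and horizontal segments in the
    logarithmic coordinate, which is why rectangles still suffice there.

    The exponent 3/p in (ii) is the sum of the two exponents in (i), since the weight is at least 1
    - |z|. *)

Lemma cabs_norm z : `|z| = (cabs z)%:C.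
Proof. by case: z => a b; rewrite normc_def. Qed.

Lemma cabs_ge0 z : 0 <= cabs z.
Proof. by case: z => a b /=; rewrite sqrtr_ge0. Qed.

Lemma cabs_eq0 z : (cabs z == 0) = (z == 0).
Proof.
apply/eqP/eqP => [/ComplexField.Normc.eq0_normc //|->].
by rewrite ComplexField.Normc.normc0.
Qed.

Lemma cabs_gt0 z : (0 < cabs z) = (z != 0).
Proof. by rewrite lt_def cabs_eq0 cabs_ge0 andbT. Qed.

Lemma cabsM z w : cabs (z * w) = cabs z * cabs w.
Proof. exact: ComplexField.Normc.normcM. Qed.

Lemma cabsV z : cabs z^-1 = (cabs z)^-1.
Proof. exact: ComplexField.Normc.normcV. Qed.

Lemma cabsN z : cabs (- z) = cabs z.
Proof. exact: normcN. Qed.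

Lemma cabsD z w : cabs (z + w) <= cabs z + cabs w.
Proof. exact: le_normcD. Qed.

Lemma cabsB z w : cabs (z - w) <= cabs z + cabs w.
Proof. by rewrite -(cabsN w) cabsD. Qed.

Lemma cabs_distC z w : cabs (z - w) = cabs (w - z).
Proof. by rewrite -cabsN opprB. Qed.

Lemma cabs_distD w z u : cabs (z - u) <= cabs (z - w) + cabs (w - u).
Proof. by rewrite (le_trans _ (cabsD _ _))// [z - w + _]addrA subrK. Qed.

Lemma cabsB_ge z w : cabs z - cabs w <= cabs (z - w).
Proof. by rewrite lerBlDr -{1}(subrK w z) cabsD. Qed.

Lemma cabsX z n : cabs (z ^+ n) = cabs z ^+ n.
Proof.
by elim: n => [|n IH]; rewrite ?expr0 ?ComplexField.Normc.normc1// !exprS cabsM IH.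
Qed.

Lemma cabs_real x : cabs (x%:C) = `|x|.
Proof. by rewrite /= expr0n /= addr0 sqrtr_sqr. Qed.

Lemma cabs_imag x : cabs (0 +i* x) = `|x|.
Proof. by rewrite /= expr0n /= add0r sqrtr_sqr. Qed.

Lemma Re_le_cabs z : `|complex.Re z| <= cabs z.
Proof. by case: z => a b /=; rewrite -sqrtr_sqr ler_wsqrtr// lerDl sqr_ge0. Qed.

Lemma Im_le_cabs z : `|complex.Im z| <= cabs z.
Proof. by case: z => a b /=; rewrite -sqrtr_sqr ler_wsqrtr// lerDr sqr_ge0. Qed.

Lemma cabs_le_ReIm z : cabs z <= `|complex.Re z| + `|complex.Im z|.
Proof.
case: z => a b; rewrite [complex.Re _]/= [complex.Im _]/=.
have -> : a +i* b = a%:C + (0 +i* b) by congr (_ +i* _); rewrite ?addr0 ?add0r.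
by rewrite (le_trans (cabsD _ _))// cabs_real cabs_imag.
Qed.

Lemma Re_mul z w : complex.Re (z * w) =
  complex.Re z * complex.Re w - complex.Im z * complex.Im w.
Proof. by case: z => a b; case: w. Qed.

Lemma Im_mul z w : complex.Im (z * w) =
  complex.Re z * complex.Im w + complex.Im z * complex.Re w.
Proof. by case: z => a b; case: w. Qed.

Lemma ReD z w : complex.Re (z + w) = complex.Re z + complex.Re w.
Proof. by case: z; case: w. Qed.

Lemma ImD z w : complex.Im (z + w) = complex.Im z + complex.Im w.
Proof. by case: z; case: w. Qed.

Lemma ReN z : complex.Re (- z) = - complex.Re z. Proof. by case: z. Qed.
Lemma ImN z : complex.Im (- z) = - complex.Im z. Proof. by case: z. Qed.

Lemma complexP z w :
  complex.Re z = complex.Re w -> complex.Im z = complex.Im w -> z = w.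
Proof. by case: z => a b; case: w => c d /= -> ->. Qed.

End ComplexModulus.

Arguments ComplexField.Normc.normc : simpl never.

(** * Continuity and complex differentiability at a point *)

Section ComplexCalculus.
Context {R : realType}.
Implicit Types (f g q : R[i] -> R[i]) (z w d : R[i]).

Definition ccont f z := forall e : R, 0 < e ->
  exists2 r : R, 0 < r & forall w, cabs (w - z) < r -> cabs (f w - f z) <= e.

(* Caratheodory's form of complex differentiability: the rules of calculus
   reduce to those for continuity. *)
Definition cder f z d := exists q,
  [/\ ccont q z, q z = d & forall w, f w - f z = q w * (w - z)].

Lemma ccont_cst (a : R[i]) z : ccont (fun=> a) z.
Proof.
move=> e e0; exists 1 => // w _.
by rewrite subrr ComplexField.Normc.normc0 ltW.
Qed.

Lemma ccont_id z : ccont id z.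
Proof. by move=> e e0; exists e => // w /ltW. Qed.

Lemma ccontD f g z : ccont f z -> ccont g z -> ccont (fun w => f w + g w) z.
Proof.
move=> cf cg e e0; have e20 : 0 < e / 2 by rewrite divr_gt0.
have [r r0 fr] := cf _ e20; have [s s0 gs] := cg _ e20.
exists (Num.min r s); first by rewrite lt_min r0.
move=> w; rewrite lt_min => /andP[/fr fw /gs gw].
rewrite (_ : _ - _ = (f w - f z) + (g w - g z)); last by ring.
by rewrite (le_trans (cabsD _ _))// [leRHS]Num.Theory.splitr lerD.
Qed.

Lemma ccont_bounded f z : ccont f z ->
  exists2 r : R, 0 < r & forall w, cabs (w - z) < r -> cabs (f w) <= cabs (f z) + 1.
Proof.
move=> /(_ 1 ltr01)[r r0 fr]; exists r => // w /fr fw.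
by rewrite -lerBlDl (le_trans (cabsB_ge _ _)).
Qed.

Lemma ccontM f g z : ccont f z -> ccont g z -> ccont (fun w => f w * g w) z.
Proof.
move=> cf cg e e0.
have [t t0 gt] := ccont_bounded cg.
have A0 : 0 < cabs (g z) + 1 by rewrite ltr_wpDl// cabs_ge0.
have B0 : 0 < cabs (f z) + 1 by rewrite ltr_wpDl// cabs_ge0.
have [r r0 fr] := cf (e / 2 / (cabs (g z) + 1)) ltac:(by rewrite !divr_gt0).
have [s s0 gs] := cg (e / 2 / (cabs (f z) + 1)) ltac:(by rewrite !divr_gt0).
exists (Num.min t (Num.min r s)); first by rewrite !lt_min t0 r0.
move=> w; rewrite !lt_min => /and3P[/gt gw /fr fw /gs gw'].
rewrite (_ : _ - _ = (f w - f z) * g w + f z * (g w - g z)); last by ring.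
rewrite (le_trans (cabsD _ _))// [leRHS]Num.Theory.splitr !cabsM lerD//.
  by rewrite -[leRHS](divfK (lt0r_neq0 A0)) ler_pM ?cabs_ge0.
rewrite mulrC -[leRHS](divfK (lt0r_neq0 B0)) ler_pM ?cabs_ge0//.
by rewrite lerDl.
Qed.

Lemma ccont_neq0 f z : ccont f z -> f z != 0 ->
  exists2 r : R, 0 < r & forall w, cabs (w - z) < r -> cabs (f z) / 2 <= cabs (f w).
Proof.
move=> cf fz0; have fz : 0 < cabs (f z) by rewrite cabs_gt0.
have [r r0 fr] := cf (cabs (f z) / 2) ltac:(by rewrite divr_gt0).
exists r => // w /fr; rewrite cabs_distC => fw.
have := le_trans (cabsB_ge _ _) fw; lra.
Qed.

Lemma ccontV f z : ccont f z -> f z != 0 -> ccont (fun w => (f w)^-1) z.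
Proof.
move=> cf fz0 e e0; have fz : 0 < cabs (f z) by rewrite cabs_gt0.
have [s s0 fs] := ccont_neq0 cf fz0.
have [r r0 fr] := cf (e * (cabs (f z) * (cabs (f z) / 2)))
  ltac:(by rewrite !mulr_gt0// divr_gt0).
exists (Num.min r s); first by rewrite lt_min r0.
move=> w; rewrite lt_min => /andP[/fr fw /fs fw'].
have fw0 : 0 < cabs (f w) by rewrite (lt_le_trans _ fw')// divr_gt0.
have nfw : f w != 0 by rewrite -cabs_gt0.
rewrite (_ : _ - _ = (f z - f w) / (f z * f w)); last first.
  by field; rewrite nfw fz0.
rewrite cabsM cabsV ler_pdivrMr ?cabs_gt0 ?mulf_neq0// cabs_distC cabsM.
by rewrite (le_trans fw)// ler_pM2l// ler_pM2l.
Qed.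

Lemma ccont_comp f g z : ccont f z -> ccont g (f z) -> ccont (fun w => g (f w)) z.
Proof.
move=> cf cg e e0; have [s s0 gs] := cg _ e0.
have [r r0 fr] := cf (s / 2) ltac:(by rewrite divr_gt0).
exists r => // w /fr fw; apply: gs; rewrite (le_lt_trans fw)//.
by rewrite ltr_pdivrMr// mulr_natr mulr2n ltrDl.
Qed.

Lemma cder_cont f z d : cder f z d -> ccont f z.
Proof.
move=> [q [cq qz fq]].
have -> : f = fun w => q w * (w + - z) + f z.
  by apply/funext => w; rewrite -fq subrK.
apply: ccontD; last exact: ccont_cst.
by apply: ccontM => //; apply: ccontD; [exact: ccont_id|exact: ccont_cst].
Qed.

Lemma cderP f z d : cder f z d <-> forall e : R, 0 < e ->
  exists2 r : R, 0 < r & forall w, cabs (w - z) < r ->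
    cabs (f w - f z - d * (w - z)) <= e * cabs (w - z).
Proof.
split=> [[q [cq <- fq]] e e0|H].
  have [r r0 qr] := cq _ e0; exists r => // w /qr qw.
  by rewrite fq -mulrBl cabsM ler_wpM2r// cabs_ge0.
exists (fun w => if w == z then d else (f w - f z) / (w - z)); split.
- move=> e e0; have [r r0 fr] := H _ e0; exists r => // w /fr fw; rewrite eqxx.
  have [_|wz] := eqVneq w z; first by rewrite subrr ComplexField.Normc.normc0 ltW.
  have wz0 : w - z != 0 by rewrite subr_eq0.
  rewrite -(ler_pM2r (_ : 0 < cabs (w - z))) ?cabs_gt0// -cabsM.
  by rewrite mulrBl divfK.
- by rewrite eqxx.
- move=> w; case: eqVneq => [->|wz]; first by rewrite !subrr mulr0.
  by rewrite divfK// subr_eq0.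
Qed.

Lemma cder_cst (a : R[i]) z : cder (fun=> a) z 0.
Proof.
exists (fun=> 0); split=> // [|w]; first exact: ccont_cst.
by rewrite subrr mul0r.
Qed.

Lemma cder_id z : cder id z 1.
Proof.
exists (fun=> 1); split=> // [|w]; first exact: ccont_cst.
by rewrite mul1r.
Qed.

Lemma cderD f g z d d' : cder f z d -> cder g z d' ->
  cder (fun w => f w + g w) z (d + d').
Proof.
move=> [q [cq <- fq]] [k [ck <- gk]].
exists (fun w => q w + k w); split=> // [|w]; first exact: ccontD.
by rewrite mulrDl -fq -gk; ring.
Qed.

Lemma cderM f g z d d' : cder f z d -> cder g z d' ->
  cder (fun w => f w * g w) z (d * g z + f z * d').
Proof.
move=> df [k [ck <- gk]]; have cf := cder_cont df; case: df => q [cq <- fq].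
exists (fun w => q w * g z + f w * k w); split=> // [|w].
  by apply: ccontD; apply: ccontM => //; exact: ccont_cst.
rewrite mulrDl -mulrA [g z * _]mulrC mulrA -fq -mulrA -gk; ring.
Qed.

Lemma cderZ (a : R[i]) f z d : cder f z d -> cder (fun w => a * f w) z (a * d).
Proof.
by move=> df; have := cderM (cder_cst a z) df; rewrite mul0r add0r.
Qed.

Lemma cderN f z d : cder f z d -> cder (fun w => - f w) z (- d).
Proof.
move=> df; rewrite -mulN1r; have -> : (fun w => - f w) = fun w => -1 * f w.
  by apply/funext => w; rewrite mulN1r.
exact: cderZ.
Qed.

Lemma cderB f g z d d' : cder f z d -> cder g z d' ->
  cder (fun w => f w - g w) z (d - d').
Proof. by move=> df dg; apply: cderD => //; exact: cderN. Qed.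

Lemma cder_comp f g z d d' : cder f z d -> cder g (f z) d' ->
  cder (fun w => g (f w)) z (d' * d).
Proof.
move=> df [k [ck <- gk]]; have cf := cder_cont df; case: df => q [cq <- fq].
exists (fun w => k (f w) * q w); split=> // [|w].
  by apply: ccontM => //; exact: (ccont_comp cf ck).
by rewrite -mulrA -fq -gk.
Qed.

Lemma cder_near f g z d : (exists2 r : R, 0 < r & forall w, cabs (w - z) < r -> f w =
    g w) ->
  cder g z d -> cder f z d.
Proof.
move=> [s s0 fg] /cderP dg; apply/cderP => e e0; have [r r0 gr] := dg _ e0.
exists (Num.min r s); first by rewrite lt_min r0.
move=> w; rewrite lt_min => /andP[/gr gw /fg ->].
by rewrite fg// subrr ComplexField.Normc.normc0.
Qed.

Lemma cderV f z d : cder f z d -> f z != 0 ->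
  cder (fun w => (f w)^-1) z (- d / f z ^+ 2).
Proof.
move=> df fz0; have cf := cder_cont df.
have [r r0 fr] := ccont_neq0 cf fz0.
have nf w : cabs (w - z) < r -> f w != 0.
  by move=> /fr fw; rewrite -cabs_gt0 (lt_le_trans _ fw)// divr_gt0 ?cabs_gt0.
case: df => q [cq qz fq].
(* Where [f] vanishes, [(f w)^-1] is the default [0] and no such factorisation holds; [g] has it
   everywhere and agrees with the inverse near [z]. *)
pose g w := (f z)^-1 + (- (q w / (f w * f z))) * (w - z).
apply: (@cder_near _ g).
  exists r => // w /nf fw0; apply: (addIr (- (f z)^-1)).
  rewrite /g addrAC subrr add0r mulNr mulrAC -fq.
  by field; rewrite fw0 fz0.
exists (fun w => (- (q w / (f w * f z)))); split.
- have -> : (fun w => - (q w / (f w * f z))) = fun w => (-1 * q w) * (f w * f z)^-1.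
    by apply/funext => w; rewrite mulN1r mulNr.
  apply: ccontM; first by apply: ccontM => //; exact: ccont_cst.
  apply: ccontV; last by rewrite mulf_neq0.
  by apply: ccontM => //; exact: ccont_cst.
- by rewrite qz expr2 mulNr.
- by move=> w; rewrite /g subrr mulr0 addr0 addrAC subrr add0r.
Qed.

Lemma cder_div f g z d d' : cder f z d -> cder g z d' -> g z != 0 ->
  cder (fun w => f w / g w) z ((d * g z - f z * d') / g z ^+ 2).
Proof.
move=> df dg gz0; have := cderM df (cderV dg gz0).
by congr cder; field.
Qed.

Lemma cder_unique f z d d' : cder f z d -> cder f z d' -> d = d'.
Proof.
move=> /cderP df /cderP dg; apply/eqP; rewrite -subr_eq0 -cabs_eq0.
apply/eqP; apply/eqP; rewrite eq_le cabs_ge0 andbT; apply/ler_addgt0Pl => e e0.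
rewrite addr0.
have e20 : 0 < e / 2 by rewrite divr_gt0.
have [r r0 fr] := df _ e20; have [s s0 gs] := dg _ e20.
pose t := Num.min r s / 2; have t0 : 0 < t by rewrite divr_gt0// lt_min r0.
have tm : t < Num.min r s.
  by rewrite ltr_pdivrMr// mulr_natr mulr2n ltrDl lt_min r0.
have wt : cabs (z + t%:C - z) = t by rewrite addrAC subrr add0r cabs_real gtr0_norm.
have := fr (z + t%:C); have := gs (z + t%:C); rewrite !wt.
move: tm; rewrite lt_min => /andP[-> ->] => /(_ isT) A /(_ isT) B.
rewrite -(ler_pM2r t0) -{1}wt -cabsM.
rewrite (_ : _ * _ = (f (z + t%:C) - f z - d' * (z + t%:C - z)) -
   (f (z + t%:C) - f z - d * (z + t%:C - z))); last by ring.
by rewrite (le_trans (cabsB _ _))// [X in _ <= X * _]Num.Theory.splitr mulrDl lerD.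
Qed.

End ComplexCalculus.

(** * Agreement with derivatives defined as limits *)

Section Bridge.
Context {R : realType}.

(** The norm of [R[i]] is [R[i]]-valued, and [0 < e] in [R[i]] says that [e] is real and positive,
    so radii and tolerances can be exchanged for elements of [R]. *)
Lemma dnbhs_cvg_cabs (g : R[i] -> R[i]) (l : R[i]) :
  ((g h : R[i]^o) @[h --> (0 : R[i]^o)^'] --> (l : R[i]^o)) <->
  forall e : R, 0 < e -> exists2 r : R, 0 < r & forall h, h != 0 -> cabs h < r ->
      cabs (g h - l) <= e.
Proof.
split.
  move=> /(@cvgrPdist_le R[i] R[i]^o) H e e0.
  have := H e%:C; rewrite ltcR => /(_ e0).
  rewrite near_withinE => /nbhs_ballP[d /= d0 dH].
  have : 0 < d by []. rewrite ltcE /= => /andP[/eqP i0 r0].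
  exists (complex.Re d) => // h h0 hd.
  have := dH h.
  rewrite -[ball _ _]/(ball_ Num.norm 0 d) /ball_ /= sub0r normrN cabs_norm.
  rewrite ltcE /= -i0 eqxx /= => /(_ hd h0).
  by rewrite distrC cabs_norm lecR.
move=> H.
apply/(@cvgrPdist_le R[i] R[i]^o) => e.
rewrite ltcE /= => /andP[/eqP i0 r0].
have [r r1 rH] := H _ r0.
rewrite near_withinE; apply/nbhs_ballP; exists r%:C; first by rewrite /= ltcR.
move=> h; rewrite -[ball _ _]/(ball_ Num.norm 0 r%:C) /ball_ /= sub0r normrN
    cabs_norm ltcR => hr h0.
by rewrite distrC cabs_norm lecE /= -i0 eqxx /= rH.
Qed.

Lemma cder_cvg (f : R[i] -> R[i]) (z d : R[i]) : cder f z d <->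
  ((h^-1 * (f (h + z) - f z) : R[i]^o) @[h --> (0 : R[i]^o)^'] --> (d : R[i]^o)).
Proof.
rewrite dnbhs_cvg_cabs; split.
  move=> /cderP H e /H[r r0 fr]; exists r => // h h0 hr.
  have := fr (h + z); rewrite addrK => /(_ hr) fh.
  rewrite -(ler_pM2r (_ : 0 < cabs h)) ?cabs_gt0// -cabsM.
  by rewrite mulrBl mulrAC mulVf// mul1r.
move=> H; apply/cderP => e /H[r r0 fr]; exists r => // w wr.
have [->|wz] := eqVneq w z; first by rewrite !subrr mulr0 subr0
    ComplexField.Normc.normc0 mulr0.
have wz0 : w - z != 0 by rewrite subr_eq0.
have := fr _ wz0 wr; rewrite subrK -(ler_pM2r (_ : 0 < cabs (w - z))) ?cabs_gt0// -cabsM.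
by rewrite mulrBl mulrAC mulVf// mul1r.
Qed.

Lemma derivable_cder (f : R[i] -> R[i]) (z : R[i]) :
  @derivable R[i] R[i]^o R[i]^o f z 1 -> cder f z (@derive1 R[i] R[i]^o f z).
Proof.
move=> df; apply/cder_cvg; rewrite derive1E.
move: df; rewrite /derivable /derive /=.
rewrite (_ : (fun h => _) = (fun h : R[i] => h^-1 * (f (h + z) - f z))) //.
by apply/funext => h; rewrite /GRing.scale /= mulr1.
Qed.

End Bridge.

(** * Integrals of complex functions of a real variable *)

Section ComplexIntegral.
Context {R : realType}.
Notation mu := (@lebesgue_measure R).
Implicit Types (a b t : R) (g : R -> R[i]).

Definition ccurve g t := forall e : R, 0 < e ->
  exists2 r : R, 0 < r & forall s, `|s - t| < r -> cabs (g s - g t) <= e.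

Lemma ccurve_comp (F : R[i] -> R[i]) g t :
  (forall s, cabs (g s - g t) <= `|s - t|) -> ccont F (g t) ->
  ccurve (fun t => F (g t)) t.
Proof.
move=> lg cF e /cF[r r0 Fr]; exists r => // s st.
by apply: Fr; exact: le_lt_trans (lg s) st.
Qed.

Lemma ccurve_continuous (h : R[i] -> R) g t :
  (forall z w, `|h z - h w| <= cabs (z - w)) -> ccurve g t ->
  {for t, continuous (fun t => h (g t))}.
Proof.
move=> lh cg; apply/cvgrPdist_le => e /cg[r r0 gr].
apply/nbhs_ballP; exists r => // s; rewrite /ball /= => st.
rewrite distrC (le_trans (lh _ _))// gr// distrC//.
Qed.

Lemma ccurve_within (h : R[i] -> R) g a b :
  (forall z w, `|h z - h w| <= cabs (z - w)) ->
  (forall t, a <= t <= b -> ccurve g t) ->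
  {within `[a, b], continuous (fun t => h (g t))}.
Proof.
move=> lh cg; apply: continuous_in_subspaceT => t; rewrite inE /= in_itv /=.
by move=> /cg; exact: ccurve_continuous.
Qed.

Lemma ccurve_integrable (h : R[i] -> R) g a b :
  (forall z w, `|h z - h w| <= cabs (z - w)) ->
  (forall t, a <= t <= b -> ccurve g t) ->
  mu.-integrable `[a, b] (EFin \o (fun t => h (g t))).
Proof.
move=> lh cg; apply: continuous_compact_integrable.
  exact: segment_compact.
exact: ccurve_within.
Qed.

Lemma Re_lip (z w : R[i]) : `|complex.Re z - complex.Re w| <= cabs (z - w).
Proof. by rewrite -ReN -ReD Re_le_cabs. Qed.

Lemma Im_lip (z w : R[i]) : `|complex.Im z - complex.Im w| <= cabs (z - w).
Proof. by rewrite -ImN -ImD Im_le_cabs. Qed.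

Lemma cabs_lip (z w : R[i]) : `|cabs z - cabs w| <= cabs (z - w).
Proof. by rewrite ler_norml cabsB_ge andbT lerNl opprB cabs_distC cabsB_ge. Qed.

Lemma Rintegrable_lin a b (f g : R -> R) (k l : R) :
  mu.-integrable `[a, b] (EFin \o f) -> mu.-integrable `[a, b] (EFin \o g) ->
  mu.-integrable `[a, b] (EFin \o (fun t => k * f t + l * g t)).
Proof.
move=> fi gi.
have mab : measurable (`[a, b] : set (measurableTypeR R)) by [].
exact: (integrableD mab (integrableZl mab k fi) (integrableZl mab l gi)).
Qed.

Lemma RintegrableZ a b (f : R -> R) (k : R) :
  mu.-integrable `[a, b] (EFin \o f) ->
  mu.-integrable `[a, b] (EFin \o (fun t => k * f t)).
Proof.
have mab : measurable (`[a, b] : set (measurableTypeR R)) by [].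
by move=> fi; exact: (integrableZl mab k fi).
Qed.

Definition cint a b g : R[i] :=
  (\int[mu]_(t in `[a, b]) complex.Re (g t)) +i*
  (\int[mu]_(t in `[a, b]) complex.Im (g t)).

Definition cintegrable a b g :=
  mu.-integrable `[a, b] (EFin \o (fun t => complex.Re (g t))) /\
  mu.-integrable `[a, b] (EFin \o (fun t => complex.Im (g t))).

Lemma ccurve_cintegrable a b g :
  (forall t, a <= t <= b -> ccurve g t) -> cintegrable a b g.
Proof. by move=> cg; split; apply: ccurve_integrable => //;
    [exact: Re_lip|exact: Im_lip]. Qed.

Lemma eq_cint a b g g' : (forall t, a <= t <= b -> g t = g' t) ->
  cint a b g = cint a b g'.
Proof.
move=> gg'; congr (_ +i* _); apply: eq_Rintegral => t;
  by rewrite inE /= in_itv /= => /gg' ->.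
Qed.

Lemma cintD a b g g' : cintegrable a b g -> cintegrable a b g' ->
  cint a b (fun t => g t + g' t) = cint a b g + cint a b g'.
Proof.
move=> [g1 g2] [h1 h2]; apply: complexP; rewrite ?ReD ?ImD /= -RintegralD//;
by apply: eq_Rintegral => t _; rewrite ?ReD ?ImD.
Qed.

Lemma cintZ a b g (k : R[i]) : cintegrable a b g ->
  cint a b (fun t => k * g t) = k * cint a b g.
Proof.
move=> [g1 g2]; apply: complexP; rewrite ?Re_mul ?Im_mul /= -!RintegralZl//.
  by rewrite -RintegralB//;
    [apply: eq_Rintegral => t _; rewrite Re_mul| |]; try exact: RintegrableZ.
by rewrite -RintegralD//;
  [apply: eq_Rintegral => t _; rewrite Im_mul| |]; try exact: RintegrableZ.
Qed.

Lemma cintegrableD a b g g' : cintegrable a b g -> cintegrable a b g' ->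
  cintegrable a b (fun t => g t + g' t).
Proof.
move=> [g1 g2] [h1 h2]; split.
  apply: eq_integrable (Rintegrable_lin 1 1 g1 h1) => // t _.
  by rewrite /= !mul1r ReD.
apply: eq_integrable (Rintegrable_lin 1 1 g2 h2) => // t _.
by rewrite /= !mul1r ImD.
Qed.

Lemma cintegrableZ a b g (k : R[i]) : cintegrable a b g ->
  cintegrable a b (fun t => k * g t).
Proof.
move=> [g1 g2]; split.
  apply: eq_integrable (Rintegrable_lin (complex.Re k) (- complex.Im k) g1 g2) => // t _.
  by rewrite /= mulNr Re_mul.
apply: eq_integrable (Rintegrable_lin (complex.Im k) (complex.Re k) g1 g2) => // t _.
by rewrite /= Im_mul addrC.
Qed.

Lemma cintB a b g g' : cintegrable a b g -> cintegrable a b g' ->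
  cint a b (fun t => g t - g' t) = cint a b g - cint a b g'.
Proof.
move=> ig ih; rewrite -mulN1r -cintZ// -cintD//; last exact: cintegrableZ.
by apply: eq_cint => t _; rewrite mulN1r.
Qed.

Lemma Rintegral_itv_cst a b (k : R) : a <= b ->
  \int[mu]_(t in `[a, b]) k = k * (b - a).
Proof.
rewrite le_eqVlt => /predU1P[->|ab]; first by rewrite set_itv1 Rintegral_set1 subrr mulr0.
by rewrite Rintegral_cst//= lebesgue_measure_itv /= lte_fin ab.
Qed.

Lemma cint_cst a b (k : R[i]) : a <= b -> cint a b (fun=> k) = (b - a)%:C * k.
Proof.
by move=> ab; apply: complexP; rewrite ?Re_mul ?Im_mul /= Rintegral_itv_cst//; ring.
Qed.

Lemma Rintegral_itv_split a e b (f : R -> R) : a <= e <= b ->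
  mu.-integrable `[a, b] (EFin \o f) ->
  \int[mu]_(t in `[a, b]) f t =
  \int[mu]_(t in `[a, e]) f t + \int[mu]_(t in `[e, b]) f t.
Proof.
move=> /andP[ae eb] fi; rewrite -(@Rintegral_itv_obnd_cbnd _ e); last first.
  apply: integrableS fi => //; apply: subset_itvr; by rewrite bnd_simp.
by rewrite -(Rintegral_itvB fi) ?bnd_simp// addrC subrK.
Qed.

Lemma cint_split a e b g : a <= e <= b -> cintegrable a b g ->
  cint a b g = cint a e g + cint e b g.
Proof.
move=> aeb [g1 g2].
by apply: complexP; rewrite ?ReD ?ImD /= (@Rintegral_itv_split a e b).
Qed.

(** Rotation: with [I] the integral, |I|^2 is the integral of Re (conj(I) g), whose integrand is at
    most |I| |g|. *)
Lemma cint_norm a b g : (forall t, a <= t <= b -> ccurve g t) ->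
  cabs (cint a b g) <= \int[mu]_(t in `[a, b]) cabs (g t).
Proof.
move=> cg; have [g1 g2] := ccurve_cintegrable cg.
have g3 := ccurve_integrable cabs_lip cg.
set I := cint a b g.
have [->|I0] := eqVneq I 0.
  by rewrite ComplexField.Normc.normc0 Rintegral_ge0// => t _; exact: cabs_ge0.
have cI : 0 < cabs I by rewrite cabs_gt0.
rewrite -(ler_pM2l cI) -RintegralZl//.
have -> : cabs I * cabs I = complex.Re I * complex.Re I + complex.Im I * complex.Im I.
  by case: (I) => x y; rewrite -expr2 /ComplexField.Normc.normc /= sqr_sqrtr
      -?expr2// addr_ge0// sqr_ge0.
rewrite {2 4}/I [complex.Re (cint _ _ _)]/= [complex.Im (cint _ _ _)]/=
    -!RintegralZl// -RintegralD//; [|exact: RintegrableZ|exact: RintegrableZ].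
apply: le_Rintegral => //.
- exact: Rintegrable_lin.
- exact: RintegrableZ.
move=> t _.
rewrite -/(complex.Re I) -/(complex.Im I).
have <- : complex.Re ((complex.Re I -i* complex.Im I) * g t) =
   complex.Re I * complex.Re (g t) + complex.Im I * complex.Im (g t).
  by rewrite Re_mul [complex.Re (_ +i* _)]/= [complex.Im (_ +i* _)]/= mulNr opprK.
rewrite (le_trans (ler_norm _))// (le_trans (Re_le_cabs _))// cabsM.
by case: (I) => x y; rewrite /ComplexField.Normc.normc /= sqrrN.
Qed.

Lemma cint_le a b g (M : R) : a <= b -> (forall t, a <= t <= b -> ccurve g t) ->
  (forall t, a <= t <= b -> cabs (g t) <= M) ->
  cabs (cint a b g) <= M * (b - a).
Proof.
move=> ab cg gM; rewrite (le_trans (cint_norm cg))//.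
rewrite -Rintegral_itv_cst//.
apply: le_Rintegral => //.
- exact: ccurve_integrable cabs_lip cg.
- apply: continuous_compact_integrable; first exact: segment_compact.
  by apply: continuous_subspaceT => x; apply: cvg_cst.
Qed.

End ComplexIntegral.
Arguments cint : simpl never.

(** * Integrals along the boundary of a rectangle *)

Section Rectangles.
Context {R : realType}.
Implicit Types (a b c d e x y M : R) (F G : R[i] -> R[i]).

Definition rcont F a b c d :=
  forall x y, a <= x <= b -> c <= y <= d -> ccont F (x +i* y).

Definition hseg F a b y := cint a b (fun x => F (x +i* y)).
Definition vseg F x c d := cint c d (fun y => F (x +i* y)).

(* The counterclockwise integral of F dz along the boundary of
   [a, b] x [c, d]; on the vertical sides dz = 'i dy. *)
Definition rint F a b c d :=
  hseg F a b c - hseg F a b d + (0 +i* 1) * (vseg F b c d - vseg F a c d).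

Lemma hline_lip y x s : cabs ((s +i* y) - (x +i* y)) <= `|s - x|.
Proof. by rewrite -cabs_real le_eqVlt; apply/orP/or_introl/eqP; congr cabs;
    congr (_ +i* _); rewrite subrr. Qed.

Lemma vline_lip x y s : cabs ((x +i* s) - (x +i* y)) <= `|s - y|.
Proof. by rewrite -cabs_imag le_eqVlt; apply/orP/or_introl/eqP; congr cabs;
    congr (_ +i* _); rewrite subrr. Qed.

Lemma hcurve F a b y : (forall x, a <= x <= b -> ccont F (x +i* y)) ->
  forall x, a <= x <= b -> ccurve (fun x => F (x +i* y)) x.
Proof. by move=> cF x /cF; apply: ccurve_comp => s; exact: hline_lip. Qed.

Lemma vcurve F x c d : (forall y, c <= y <= d -> ccont F (x +i* y)) ->
  forall y, c <= y <= d -> ccurve (fun y => F (x +i* y)) y.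
Proof. by move=> cF y /cF; apply: ccurve_comp => s; exact: vline_lip. Qed.

Lemma rcontB F G a b c d : rcont F a b c d -> rcont G a b c d ->
  rcont (fun z => F z - G z) a b c d.
Proof.
move=> cF cG x y xab ycd; rewrite (_ : (fun z => _) = fun z => F z + (-1) * G z).
  by apply: ccontD; [exact: cF|apply: ccontM; [exact: ccont_cst|exact: cG]].
by apply/funext => z; rewrite mulN1r.
Qed.

Lemma rint_splitx F a e b c d : a <= e <= b -> c <= d -> rcont F a b c d ->
  rint F a b c d = rint F a e c d + rint F e b c d.
Proof.
move=> aeb cd cF; rewrite /rint /hseg !(@cint_split _ a e b)//; first by ring.
  by apply/ccurve_cintegrable/hcurve => x xab; apply: cF; rewrite // cd lexx.
by apply/ccurve_cintegrable/hcurve => x xab; apply: cF; rewrite // cd lexx.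
Qed.

Lemma rint_splity F a b c e d : c <= e <= d -> a <= b -> rcont F a b c d ->
  rint F a b c d = rint F a b c e + rint F a b e d.
Proof.
move=> ced ab cF; rewrite /rint /vseg !(@cint_split _ c e d)//; first by ring.
  by apply/ccurve_cintegrable/vcurve => y ycd; apply: cF; rewrite // ab lexx.
by apply/ccurve_cintegrable/vcurve => y ycd; apply: cF; rewrite // ab lexx.
Qed.

Definition on_boundary a b c d x y : Prop :=
  [/\ a <= x <= b, c <= y <= d & [\/ x = a, x = b, y = c | y = d]].

(** Continuity is asked at boundary points only, because the Cauchy kernel is discontinuous at its
    pole inside the rectangle. *)
Definition bcont F a b c d :=
  forall x y, on_boundary a b c d x y -> ccont F (x +i* y).

Lemma on_boundary_sides a b c d : a <= b -> c <= d ->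
  [/\ forall x, a <= x <= b -> on_boundary a b c d x c,
      forall x, a <= x <= b -> on_boundary a b c d x d,
      forall y, c <= y <= d -> on_boundary a b c d a y &
      forall y, c <= y <= d -> on_boundary a b c d b y].
Proof.
move=> ab cd; split=> t tI; split; rewrite ?lexx ?ab ?cd//;
  by [constructor 3|constructor 4|constructor 1|constructor 2].
Qed.

Lemma rcont_bcont F a b c d : rcont F a b c d -> bcont F a b c d.
Proof. by move=> cF x y [xab ycd _]; exact: cF. Qed.

Lemma bcont_integrable F a b c d : a <= b -> c <= d -> bcont F a b c d ->
  [/\ cintegrable a b (fun x => F (x +i* c)), cintegrable a b (fun x => F (x +i* d)),
     cintegrable c d (fun y => F (a +i* y)) & cintegrable c d (fun y => F (b +i* y))].
Proof.
move=> ab cd cF; have [ob1 ob2 ob3 ob4] := on_boundary_sides ab cd.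
split; apply: ccurve_cintegrable; [apply: hcurve|apply: hcurve|apply: vcurve|apply:
    vcurve];
  by move=> t tI; apply: cF; auto.
Qed.

Lemma rintB F G a b c d : a <= b -> c <= d -> bcont F a b c d -> bcont G a b c d ->
  rint (fun z => F z - G z) a b c d = rint F a b c d - rint G a b c d.
Proof.
move=> ab cd /(bcont_integrable ab cd)[f1 f2 f3 f4] /(bcont_integrable ab cd)[g1 g2
    g3 g4].
by rewrite /rint /hseg /vseg !cintB//; ring.
Qed.

Lemma rintZ F a b c d (k : R[i]) : a <= b -> c <= d -> bcont F a b c d ->
  rint (fun z => k * F z) a b c d = k * rint F a b c d.
Proof.
move=> ab cd /(bcont_integrable ab cd)[f1 f2 f3 f4].
by rewrite /rint /hseg /vseg !cintZ//; ring.
Qed.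

Lemma eq_rint F G a b c d : a <= b -> c <= d ->
  (forall x y, on_boundary a b c d x y -> F (x +i* y) = G (x +i* y)) ->
  rint F a b c d = rint G a b c d.
Proof.
move=> ab cd FG; rewrite /rint /hseg /vseg; congr (_ - _ + _ * (_ - _));
  apply: eq_cint => t tab; apply: FG; split; rewrite ?lexx ?ab ?cd//;
  by [constructor 1|constructor 2|constructor 3|constructor 4].
Qed.

Lemma rint_le F a b c d M : a <= b -> c <= d -> rcont F a b c d ->
  (forall x y, a <= x <= b -> c <= y <= d -> cabs (F (x +i* y)) <= M) ->
  cabs (rint F a b c d) <= 2 * M * ((b - a) + (d - c)).
Proof.
move=> ab cd cF FM; rewrite /rint (le_trans (cabsD _ _))//.
rewrite [leRHS](_ : _ = (M * (b - a) + M * (b - a)) + (M * (d - c) + M * (d - c)));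
    last by ring.
rewrite cabsM cabs_imag normr1 mul1r lerD// (le_trans (cabsB _ _))// lerD//;
  apply: cint_le => //; try first [apply: hcurve | apply: vcurve]; move=> t tab;
  first [apply: cF | apply: FM]; by rewrite // ?ab ?cd lexx.
Qed.

Lemma rcont_affine a b c d (k l : R[i]) : rcont (fun z => k + l * z) a b c d.
Proof.
move=> x y _ _; apply: ccontD; first exact: ccont_cst.
by apply: ccontM; [exact: ccont_cst|exact: ccont_id].
Qed.

(** On opposite sides the values differ by a constant, and the contributions of the two pairs of
    sides are opposite. *)
Lemma rint_affine a b c d (k l : R[i]) : a <= b -> c <= d ->
  rint (fun z => k + l * z) a b c d = 0.
Proof.
move=> ab cd; rewrite /rint.
have H y : cintegrable a b (fun x => k + l * (x +i* y)).
  by apply/ccurve_cintegrable/(@hcurve (fun z => k + l * z)) => x xab;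
      apply: (@rcont_affine x x y y); rewrite lexx.
have V x : cintegrable c d (fun y => k + l * (x +i* y)).
  by apply/ccurve_cintegrable/(@vcurve (fun z => k + l * z)) => y ycd;
      apply: (@rcont_affine x x y y); rewrite lexx.
have -> : hseg (fun z => k + l * z) a b c - hseg (fun z => k + l * z) a b d =
    cint a b (fun=> l * (0 +i* (c - d))).
  rewrite /hseg -cintB//; apply: eq_cint => x _.
  rewrite opprD addrACA subrr add0r -mulrBr; congr (_ * _).
  by congr (_ +i* _); rewrite subrr.
have -> : vseg (fun z => k + l * z) b c d - vseg (fun z => k + l * z) a c d =
    cint c d (fun=> l * (b - a)%:C).
  rewrite /vseg -cintB//; apply: eq_cint => y _.
  rewrite opprD addrACA subrr add0r -mulrBr; congr (_ * _).
  by congr (_ +i* _); rewrite subrr.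
rewrite !cint_cst//; apply: complexP; rewrite ?(ReD, ImD, Re_mul, Im_mul) /=; ring.
Qed.
End Rectangles.
Arguments rint : simpl never.
Arguments hseg : simpl never.
Arguments vseg : simpl never.

(** * Goursat's lemma *)

Section Goursat.
Context {R : realType}.
Implicit Types (a b c d e x y M : R) (F G : R[i] -> R[i]).

(** The supremum of the left ends works: by monotonicity every left end lies below every right
    end. *)
Lemma nested_intervals (u l : nat -> R) :
  (forall n, u n <= u n.+1) -> (forall n, u n.+1 + l n.+1 <= u n + l n) ->
  (forall n, 0 <= l n) -> exists x, forall n, u n <= x <= u n + l n.
Proof.
move=> u1 ul l0.
have nd : {homo u : m n / (m <= n)%N >-> m <= n} by apply: homo_leq => //;
    exact: le_trans.
have ni : {homo (fun n => u n + l n) : m n / (m <= n)%N >-> n <= m}.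
  by apply: homo_leq => // x y z xy yz; exact: le_trans yz xy.
have um m n : u m <= u n + l n.
  have [mn|nm] := leqP m n; first by rewrite (le_trans (nd _ _ mn))// lerDl.
  by rewrite (le_trans _ (ni _ _ (ltnW nm)))// lerDl.
have us : has_sup (range u).
  by split; [exists (u 0%N), 0%N|exists (u 0%N + l 0%N) => _ [m _ <-]].
exists (sup (range u)) => n; rewrite sup_upper_bound//=; last by exists n.
by apply: ge_sup; [exists (u 0%N), 0%N|move=> _ [m _ <-]].
Qed.

Lemma archi_pow2 (x : R) : exists n, x < 2 ^+ n.
Proof.
exists (Num.bound `|x|); rewrite (le_lt_trans (ler_norm x))//.
rewrite (lt_trans (archi_boundP (normr_ge0 _)))// -natrX ltr_nat.
exact: ltn_expl.
Qed.

Lemma cabs_quarter (z1 z2 z3 z4 : R[i]) (m : R) : m <= cabs (z1 + z2 + z3 + z4) ->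
  [\/ m / 4 <= cabs z1, m / 4 <= cabs z2, m / 4 <= cabs z3 | m / 4 <= cabs z4].
Proof.
move=> mz.
have [?|h1] := leP (m / 4) (cabs z1); first by constructor 1.
have [?|h2] := leP (m / 4) (cabs z2); first by constructor 2.
have [?|h3] := leP (m / 4) (cabs z3); first by constructor 3.
have [?|h4] := leP (m / 4) (cabs z4); first by constructor 4.
exfalso.
have := cabsD (z1 + z2 + z3) z4; have := cabsD (z1 + z2) z3; have := cabsD z1 z2.
move: mz; lra.
Qed.

Lemma subrect_step F a b c d m L H x y : rcont F a b c d ->
  0 <= L -> 0 <= H -> a <= x -> x + L + L <= b -> c <= y -> y + H + H <= d ->
  m <= cabs (rint F x (x + L + L) y (y + H + H)) ->
  exists x' y', [/\ x <= x' <= x + L, y <= y' <= y + H &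
    m / 4 <= cabs (rint F x' (x' + L) y' (y' + H))].
Proof.
move=> cF L0 H0 ax xb cy yd.
have cF' : rcont F x (x + L + L) y (y + H + H).
  move=> s t /andP[s1 s2] /andP[t1 t2]; apply: cF.
    by rewrite (le_trans ax s1) (le_trans s2 xb).
  by rewrite (le_trans cy t1) (le_trans t2 yd).
rewrite (@rint_splitx _ _ _ (x + L))//; [|lra|lra].
have [cl cr] : rcont F x (x + L) y (y + H + H) /\ rcont F (x + L) (x + L + L) y (y +
    H + H).
  by split=> s t s1 t1; apply: cF' => //; lra.
rewrite (@rint_splity _ _ x _ _ (y + H))//; [|lra|lra].
rewrite (@rint_splity _ _ (x + L) _ _ (y + H))//; [|lra|lra].
rewrite addrA => /cabs_quarter[] h.
- by exists x, y; rewrite h; split=> //; lra.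
- by exists x, (y + H); rewrite h; split=> //; lra.
- by exists (x + L), y; rewrite h; split=> //; lra.
- by exists (x + L), (y + H); rewrite h; split=> //; lra.
Qed.

Theorem goursat F a b c d : a <= b -> c <= d ->
  (forall x y, a <= x <= b -> c <= y <= d -> exists D, cder F (x +i* y) D) ->
  rint F a b c d = 0.
Proof.
move=> ab cd dF; apply/eqP; rewrite -cabs_eq0; apply/negPn/negP => I0.
have cF : rcont F a b c d by move=> x y xab ycd; have [D /cder_cont] := dF _ _ xab ycd.
set m := cabs (rint F a b c d) in I0.
have m0 : 0 < m by rewrite lt_def I0 cabs_ge0.
pose L n := (b - a) / 2 ^+ n; pose H n := (d - c) / 2 ^+ n.
have L0 n : 0 <= L n by rewrite divr_ge0 ?subr_ge0// exprn_ge0.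
have H0 n : 0 <= H n by rewrite divr_ge0 ?subr_ge0// exprn_ge0.
have LS n : L n = L n.+1 + L n.+1.
  by rewrite /L exprS; field; rewrite expf_neq0.
have HS n : H n = H n.+1 + H n.+1.
  by rewrite /H exprS; field; rewrite expf_neq0.
pose P n (s : R * R) := [/\ a <= s.1 /\ s.1 + L n <= b, c <= s.2 /\ s.2 + H n <= d &
  m / 4 ^+ n <= cabs (rint F s.1 (s.1 + L n) s.2 (s.2 + H n))].
(* The implication sits under the existential so that [choice] yields a total function on all pairs;
   where [P] fails, the value [(0, 0)] is arbitrary. *)
have step (ns : nat * (R * R)) : exists s', P ns.1 ns.2 ->
    [/\ P ns.1.+1 s', ns.2.1 <= s'.1 /\ s'.1 + L ns.1.+1 <= ns.2.1 + L ns.1 &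
      ns.2.2 <= s'.2 /\ s'.2 + H ns.1.+1 <= ns.2.2 + H ns.1].
  case: ns => n [x y] /=.
  have [Ps|nP] := pselect (P n (x, y)); last by exists (0, 0) => /nP.
  case: Ps => /= -[ax xb] [cy yd]; rewrite LS HS !addrA => hm.
  have xb' : x + L n.+1 + L n.+1 <= b by rewrite -addrA -LS.
  have yd' : y + H n.+1 + H n.+1 <= d by rewrite -addrA -HS.
  have [x' [y' [/andP[x1 x2] /andP[y1 y2] h]]] :=
    subrect_step cF (L0 n.+1) (H0 n.+1) ax xb' cy yd' hm.
  exists (x', y') => _; split => /=; [|lra|lra].
  move: xb yd; rewrite LS HS => xb yd.
  split => /=; [lra|lra|].
  by rewrite exprS [4 * _]mulrC invfM mulrA.
have [f fP] := choice step.
pose u := fix u n := if n is n'.+1 then f (n', u n') else (a, c).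
have Pu n : P n (u n).
  elim: n => [|n /(fP (n, u n))[]//].
  by rewrite /P /L /H /= !expr0 !divr1 !lexx ![_ + (_ - _)]addrC !subrK !lexx.
have [x xP] : exists x, forall n, (u n).1 <= x <= (u n).1 + L n.
  by apply: nested_intervals => // n; have [_ [h1 h2] _] := fP (n, u n) (Pu n).
have [y yP] : exists y, forall n, (u n).2 <= y <= (u n).2 + H n.
  by apply: nested_intervals => // n; have [_ _ [h1 h2]] := fP (n, u n) (Pu n).
have [D /cderP DF] : exists D, cder F (x +i* y) D.
  have := xP 0%N; have := yP 0%N; rewrite /= /L /H expr0 !divr1 => hy hx.
  by apply: dF; lra.
pose S := (b - a) + (d - c).
have S0 : 0 <= S by rewrite addr_ge0// subr_ge0.
(* The final comparison dictates the tolerance e = m / (4 (S^2 + 1)): on the n-th rectangle the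
   error is at most 2 e (S / 2^n)^2, which is below m / 4^n. The added 1 covers the degenerate
   rectangle, where S = 0. *)
have S1 : 0 < S ^+ 2 + 1 by rewrite ltr_wpDl// sqr_ge0.
have e0 : 0 < m / (4 * (S ^+ 2 + 1)) by rewrite divr_gt0// mulr_gt0.
have [r r0 Fr] := DF _ e0.
have [n nP] := archi_pow2 (S / r).
have p0 : 0 < 2 ^+ n :> R by rewrite exprn_gt0.
have Sn : L n + H n < r.
  by rewrite /L /H -mulrDl ltr_pdivrMr// mulrC -ltr_pdivrMr.
have [[au ub] [cu ud] mn] := Pu n.
have /andP[x1 x2] := xP n; have /andP[y1 y2] := yP n.
pose k := F (x +i* y) - D * (x +i* y).
have cFn : rcont F (u n).1 ((u n).1 + L n) (u n).2 ((u n).2 + H n).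
  by move=> s t sp tp; apply: cF; lra.
(* The tangent [k + D * z] at the limit point can be subtracted freely, its integral being [0]; the
   integral of the remainder is small compared with the square of the size of the rectangle. *)
have : cabs (rint (fun z => F z - (k + D * z)) (u n).1 ((u n).1 + L n) (u n).2 ((u
    n).2 + H n))
    <= 2 * (m / (4 * (S ^+ 2 + 1)) * (L n + H n)) *
       (((u n).1 + L n - (u n).1) + ((u n).2 + H n - (u n).2)).
  apply: rint_le; rewrite ?lerDl//.
    by apply: rcontB => //; exact: rcont_affine.
  move=> s t sp tp.
  have dist : cabs ((s +i* t) - (x +i* y)) <= L n + H n.
    rewrite (le_trans (cabs_le_ReIm _))//= lerD// ler_norml; lra.
  rewrite (_ : _ - _ = F (s +i* t) - F (x +i* y) - D * ((s +i* t) - (x +i* y)));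
      last first.
    by rewrite /k; ring.
  by rewrite (le_trans (Fr _ (le_lt_trans dist Sn)))// ler_pM2l.
rewrite rintB ?lerDl//; [|exact: rcont_bcont|exact/rcont_bcont/rcont_affine].
rewrite rint_affine ?lerDl// subr0 => /(le_trans mn).
rewrite ![_ + _ - _]addrAC !subrr !add0r.
have -> : L n + H n = S / 2 ^+ n by rewrite /L /H -mulrDl.
have -> : 4 ^+ n = 2 ^+ n * 2 ^+ n :> R by rewrite -exprMn -natrM.
apply/negP; rewrite -ltNge.
rewrite (_ : _ * _ = (m / (2 ^+ n * 2 ^+ n)) * ((S ^+ 2 / (S ^+ 2 + 1)) / 2)); last first.
  by field; rewrite !gt_eqF.
rewrite gtr_pMr ?divr_gt0 ?mulr_gt0// ltr_pdivrMr// ltr_pdivrMr//; nra.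
Qed.
End Goursat.

(** * Cauchy's formula on rectangles *)

Section Cauchy.
Context {R : realType}.
Notation mu := (@lebesgue_measure R).
Implicit Types (a b c d e x y r s M : R) (F G f : R[i] -> R[i]).

(** Cutting off four rectangles that avoid the exceptional point leaves a square of half side [h]
    around it, where [F] is bounded by continuity, so the integral is O(h). *)
Lemma rint_removable F a b c d x0 y0 : a < x0 < b -> c < y0 < d ->
  rcont F a b c d ->
  (forall x y, a <= x <= b -> c <= y <= d -> (x, y) != (x0, y0) ->
    exists D, cder F (x +i* y) D) ->
  rint F a b c d = 0.
Proof.
move=> /andP[ax xb] /andP[cy yd] cF dF.
have shrink h : 0 < h -> a <= x0 - h -> x0 + h <= b -> c <= y0 - h -> y0 + h <= d ->
  rint F a b c d = rint F (x0 - h) (x0 + h) (y0 - h) (y0 + h).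
  move=> h0 ah hb ch hd.
  have gz a' b' c' d' : a <= a' -> a' <= b' -> b' <= b -> c <= c' -> c' <= d' -> d'
      <= d ->
     ~ (a' <= x0 <= b' /\ c' <= y0 <= d') -> rint F a' b' c' d' = 0.
    move=> aa ab bb cc cd dd n0; apply: goursat => // x y xab ycd; apply: dF; try lra.
    by apply/eqP => -[xx yy]; apply: n0; rewrite -xx -yy.
  have sub a' b' c' d' : a <= a' -> b' <= b -> c <= c' -> d' <= d -> rcont F a' b' c' d'.
    by move=> aa bb cc dd x y xab ycd; apply: cF; lra.
  rewrite (@rint_splitx _ F a (x0 - h))//; [|lra|lra].
  rewrite (@rint_splitx _ F (x0 - h) (x0 + h))//; [|lra|lra|by apply: sub; lra].
  have -> : rint F a (x0 - h) c d = 0 by apply: gz; lra.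
  have -> : rint F (x0 + h) b c d = 0 by apply: gz; lra.
  rewrite add0r addr0.
  rewrite (@rint_splity _ F _ _ c (y0 - h))//; [|lra|lra|by apply: sub; lra].
  rewrite (@rint_splity _ F _ _ (y0 - h) (y0 + h))//; [|lra|lra|by apply: sub; lra].
  have -> : rint F (x0 - h) (x0 + h) c (y0 - h) = 0 by apply: gz; lra.
  have -> : rint F (x0 - h) (x0 + h) (y0 + h) d = 0 by apply: gz; lra.
  by rewrite add0r addr0.
have [r r0 Fr] : exists2 r : R, 0 < r & forall w, cabs (w - (x0 +i* y0)) < r ->
    cabs (F w) <= cabs (F (x0 +i* y0)) + 1.
  by apply: ccont_bounded; apply: cF; lra.
set K := cabs _ + 1 in Fr.
have K0 : 0 < K by rewrite ltr_wpDl// cabs_ge0.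
pose m := Num.min (r / 4) (Num.min (Num.min (x0 - a) (b - x0)) (Num.min (y0 - c) (d -
    y0))).
have m0 : 0 < m by rewrite !lt_min divr_gt0// !subr_gt0 ax xb cy.
(* [8 * K * h] is the bound [K] times the perimeter of the square. *)
have small h : 0 < h -> h <= m -> cabs (rint F a b c d) <= 8 * K * h.
  rewrite !le_min => h0 /and3P[hr /andP[h1 h2] /andP[h3 h4]].
  rewrite (shrink h)//; [|lra..].
  rewrite [leRHS](_ : _ = 2 * K * ((x0 + h - (x0 - h)) + (y0 + h - (y0 - h))));
      last by ring.
  apply: rint_le; try lra; first by move=> x y xh yh; apply: cF; lra.
  move=> x y xh yh; apply: Fr.
  rewrite (le_lt_trans (cabs_le_ReIm _))//=.
  have : `|x - x0| <= h by rewrite ler_norml; lra.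
  have : `|y - y0| <= h by rewrite ler_norml; lra.
  by move: hr r0; lra.
apply/eqP; rewrite -cabs_eq0 eq_le cabs_ge0 andbT; apply/ler_addgt0Pl => e e0.
rewrite addr0.
pose h := Num.min m (e / (8 * K)).
have h0 : 0 < h by rewrite lt_min m0 divr_gt0// mulr_gt0.
rewrite (le_trans (small h h0 _))//; first by rewrite ge_min lexx.
by rewrite mulrC -ler_pdivlMr ?mulr_gt0// ge_min lexx orbT.
Qed.

Lemma boundary_dist a b c d x0 y0 s x y :
  s <= x0 - a -> s <= b - x0 -> s <= y0 - c -> s <= d - y0 ->
  on_boundary a b c d x y -> s <= cabs ((x +i* y) - (x0 +i* y0)).
Proof.
move=> h1 h2 h3 h4 [_ _ H].
have := Re_le_cabs ((x +i* y) - (x0 +i* y0)).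
have := Im_le_cabs ((x +i* y) - (x0 +i* y0)); rewrite /=.
have := ler_norm (x - x0); have := ler_norm (y - y0).
have := ler_norm (- (x - x0)); have := ler_norm (- (y - y0)); rewrite !normrN.
by case: H => ->; lra.
Qed.

Lemma boundary_radius a b c d x0 y0 : a < x0 < b -> c < y0 < d ->
  exists2 s : R, 0 < s & forall x y, on_boundary a b c d x y ->
     s <= cabs ((x +i* y) - (x0 +i* y0)).
Proof.
move=> /andP[ax xb] /andP[cy yd].
exists (Num.min (Num.min (x0 - a) (b - x0)) (Num.min (y0 - c) (d - y0))).
  by rewrite !lt_min !subr_gt0 ax xb cy.
by move=> x y; apply: boundary_dist; rewrite !ge_min lexx ?orbT.
Qed.

Lemma boundary_neq a b c d x0 y0 x y : a < x0 < b -> c < y0 < d ->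
  on_boundary a b c d x y -> (x +i* y) - (x0 +i* y0) != 0.
Proof.
move=> xab ycd xy; have [s s0 sd] := boundary_radius xab ycd.
by rewrite -cabs_gt0 (lt_le_trans s0)// sd.
Qed.

Lemma ccont_kernel F (z w : R[i]) n : ccont F w -> w - z != 0 ->
  ccont (fun u => F u * (u - z)^-1 ^+ n) w.
Proof.
move=> cF nz; apply: ccontM => //; elim: n => [|n IH].
  rewrite (_ : (fun u => _) = fun=> 1); first exact: ccont_cst.
  by apply/funext => u; rewrite expr0.
rewrite (_ : (fun u => _) = fun u => (u - z)^-1 * (u - z)^-1 ^+ n); last first.
  by apply/funext => u; rewrite exprS.
apply: ccontM => //; apply: ccontV => //.
by apply: ccontD; [exact: ccont_id|exact: ccont_cst].
Qed.

Lemma bcont_kernel F a b c d x0 y0 n : a < x0 < b -> c < y0 < d -> bcont F a b c d ->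
  bcont (fun w => F w * (w - (x0 +i* y0))^-1 ^+ n) a b c d.
Proof.
move=> xab ycd cF x y xy; apply: ccont_kernel; first exact: cF.
exact: boundary_neq xy.
Qed.

(** The Caratheodory slope [q] of [f] at [z0] is continuous at [z0] and equals (f w - f z0) / (w -
    z0) elsewhere, so its integral vanishes by [rint_removable]; splitting the quotient on the
    boundary gives the formula. *)
Lemma cauchy_formula f a b c d x0 y0 : a < x0 < b -> c < y0 < d ->
  (forall x y, a <= x <= b -> c <= y <= d -> exists D, cder f (x +i* y) D) ->
  rint (fun w => f w * (w - (x0 +i* y0))^-1) a b c d =
  f (x0 +i* y0) * rint (fun w => (w - (x0 +i* y0))^-1) a b c d.
Proof.
move=> xab ycd df; set z0 := x0 +i* y0.
have [ax xb] := andP xab; have [cy yd] := andP ycd.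
have [D [q [cq qz fq]]] : exists D, cder f z0 D by apply: df; lra.
have qE w : w != z0 -> q w = (f w - f z0) * (w - z0)^-1.
  by move=> wz; rewrite fq mulfK// subr_eq0.
have dq x y : a <= x <= b -> c <= y <= d -> (x, y) != (x0, y0) ->
    exists D, cder q (x +i* y) D.
  move=> xx yy xyn; have [D' dD] := df _ _ xx yy.
  have nz : x +i* y != z0 by apply: contra xyn => /eqP[-> ->].
  have nz' : (x +i* y) - z0 != 0 by rewrite subr_eq0.
  have dg := cder_div (cderB dD (cder_cst (f z0) _)) (cderB (cder_id _) (cder_cst z0
      _)) nz'.
  eexists; apply: cder_near dg.
  exists (cabs ((x +i* y) - z0)); first by rewrite cabs_gt0 subr_eq0.
  move=> w wr; apply: qE; apply: contraPneq wr => ->.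
  by rewrite cabs_distC; apply/negP; rewrite -leNgt.
have rq : rcont q a b c d.
  move=> x y xx yy; have [[-> ->]|nz] := eqVneq (x, y) (x0, y0).
    by have := cq; rewrite -/z0.
  by have [D' /cder_cont] := dq _ _ xx yy nz.
have := rint_removable xab ycd rq dq.
have bf : bcont f a b c d.
  by move=> x y [xx yy _]; have [D' /cder_cont] := df _ _ xx yy.
have ab : a <= b by lra.
have cd : c <= d by lra.
have b1 := bcont_kernel 1 xab ycd bf.
have b2 := bcont_kernel 1 xab ycd (fun x y _ => ccont_cst (f z0) (x +i* y)).
have b3 : bcont (fun w => (w - z0)^-1) a b c d.
  rewrite (_ : (fun w => _) = fun w => 1 * ((w - z0)^-1) ^+ 1).
    by apply: bcont_kernel => // x y _; exact: ccont_cst.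
  by apply/funext => w; rewrite mul1r.
rewrite (@eq_rint _ _ (fun w => f w * ((w - z0)^-1) ^+ 1 - f z0 * ((w - z0)^-1) ^+
    1))//; last first.
  move=> x y xy; rewrite expr1 qE ?mulrBl// -subr_eq0.
  exact: boundary_neq xy.
rewrite rintB// => /eqP; rewrite subr_eq0 => /eqP E.
by rewrite -[LHS]/(rint (fun w => f w * ((w - z0)^-1) ^+ 1) a b c d) E -rintZ.
Qed.

End Cauchy.

(** * The integral of the Cauchy kernel, and differentiation under the integral sign *)

Section CauchyKernel.
Context {R : realType}.
Notation mu := (@lebesgue_measure R).
Implicit Types (a b c d e x y r s t M : R) (F G f : R[i] -> R[i]).

Lemma Rintegral_itv_ge a b (g : R -> R) M : a <= b ->
  mu.-integrable `[a, b] (EFin \o g) -> (forall t, a <= t <= b -> M <= g t) ->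
  M * (b - a) <= \int[mu]_(t in `[a, b]) g t.
Proof.
move=> ab gi gM; rewrite -Rintegral_itv_cst//.
apply: le_Rintegral => //; apply: continuous_compact_integrable;
    first exact: segment_compact.
by apply: continuous_subspaceT => x; apply: cvg_cst.
Qed.

Lemma Rintegral_itv_le a b (g : R -> R) M : a <= b ->
  mu.-integrable `[a, b] (EFin \o g) -> (forall t, a <= t <= b -> g t <= M) ->
  \int[mu]_(t in `[a, b]) g t <= M * (b - a).
Proof.
move=> ab gi gM; rewrite -Rintegral_itv_cst//.
apply: le_Rintegral => //; apply: continuous_compact_integrable;
    first exact: segment_compact.
by apply: continuous_subspaceT => x; apply: cvg_cst.
Qed.

Lemma ReV_pt x y : complex.Re ((x +i* y)^-1) = x / (x ^+ 2 + y ^+ 2).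
Proof. by []. Qed.

Lemma ImV_pt x y : complex.Im ((x +i* y)^-1) = - (y / (x ^+ 2 + y ^+ 2)).
Proof. by []. Qed.

Lemma inv_part_ge s t x y : 0 < s -> s <= y <= t -> - t <= x <= t ->
  s / (2 * t ^+ 2) <= y / (x ^+ 2 + y ^+ 2).
Proof.
move=> s0 /andP[sy yt] /andP[xt tx].
have t0 : 0 < t by lra.
have y0 : 0 < y by lra.
have x2 : x ^+ 2 <= t ^+ 2 by nra.
have y2 : y ^+ 2 <= t ^+ 2 by nra.
have p : 0 < x ^+ 2 + y ^+ 2 by rewrite ltr_wpDl ?sqr_ge0// exprn_gt0.
rewrite ler_pdivlMr// mulrAC ler_pdivrMr ?mulr_gt0// ?exprn_gt0//.
rewrite ler_pM//; lra.
Qed.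

Lemma bcont_inv a b c d x0 y0 : a < x0 < b -> c < y0 < d ->
  bcont (fun w => (w - (x0 +i* y0))^-1) a b c d.
Proof.
move=> xab ycd.
rewrite (_ : (fun w => _) = fun w => 1 * ((w - (x0 +i* y0))^-1) ^+ 1).
  by apply: bcont_kernel => // x y _; exact: ccont_cst.
by apply/funext => w; rewrite mul1r.
Qed.

(* The imaginary part is 2 pi; a positive lower bound is all that is needed. *)
Lemma index_ge a b c d x0 y0 s t : 0 < s ->
  s <= x0 - a <= t -> s <= b - x0 <= t -> s <= y0 - c <= t -> s <= d - y0 <= t ->
  4 * (s ^+ 2 / t ^+ 2) <=
  complex.Im (rint (fun w => (w - (x0 +i* y0))^-1) a b c d).
Proof.
move=> s0 ha hb hc hd; have t0 : 0 < t by lra.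
have ab : a <= b by lra.
have cd : c <= d by lra.
have xab : a < x0 < b by lra.
have ycd : c < y0 < d by lra.
have [[_ i1] [_ i2] [i3 _] [i4 _]] := bcont_integrable ab cd (bcont_inv xab ycd).
rewrite /rint ImD ImD ImN Im_mul ReD ReN
  [complex.Re (0 +i* 1)]/= [complex.Im (0 +i* 1)]/= mul0r add0r mul1r.
(* On each side the part of the kernel that counts (imaginary on horizontal sides, real on vertical
   ones) is at least [m] in absolute value, with the favourable sign. Each side has length at least
   [2 * s], hence contributes at least s^2 / t^2. *)
pose m := s / (2 * t ^+ 2).
have m0 : 0 < m by rewrite divr_gt0// mulr_gt0// exprn_gt0.
have sm : s ^+ 2 / t ^+ 2 = m * (2 * s) by rewrite /m; field; rewrite gt_eqF.
have H1 : m * (b - a) <= complex.Im (hseg (fun w => (w - (x0 +i* y0))^-1) a b c).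
  apply: Rintegral_itv_ge => // x xx.
  rewrite [X in X^-1](_ : _ = (x - x0) +i* (c - y0))//
      ImV_pt -mulNr opprB -(sqrrN (c - y0)) opprB.
  by apply: inv_part_ge => //; lra.
have H2 : complex.Im (hseg (fun w => (w - (x0 +i* y0))^-1) a b d) <= (- m) * (b - a).
  apply: Rintegral_itv_le => // x xx.
  rewrite [X in X^-1](_ : _ = (x - x0) +i* (d - y0))// ImV_pt lerN2.
  by apply: inv_part_ge => //; lra.
have H3 : m * (d - c) <= complex.Re (vseg (fun w => (w - (x0 +i* y0))^-1) b c d).
  apply: Rintegral_itv_ge => // y yy.
  rewrite [X in X^-1](_ : _ = (b - x0) +i* (y - y0))// ReV_pt.
  by rewrite [X in _ / X]addrC; apply: inv_part_ge => //; lra.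
have H4 : complex.Re (vseg (fun w => (w - (x0 +i* y0))^-1) a c d) <= (- m) * (d - c).
  apply: Rintegral_itv_le => // y yy.
  rewrite [X in X^-1](_ : _ = (a - x0) +i* (y - y0))// ReV_pt lerNr -mulNr opprB.
  by rewrite -(sqrrN (a - x0)) opprB [X in _ / X]addrC; apply: inv_part_ge => //; lra.
rewrite sm.
have : m * (2 * s) <= m * (b - a) by rewrite ler_pM2l//; lra.
have : m * (2 * s) <= m * (d - c) by rewrite ler_pM2l//; lra.
lra.
Qed.

(** The remainder of [k] is quadratic in [z - z0] uniformly along the segment, so after integration
    against [F] the error is at most M I |z - z0|^2, with [I] the integral of |F|. *)
Lemma cder_cint F (g : R -> R[i]) (k : R[i] -> R[i] -> R[i]) (k' : R[i] -> R[i])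
    (z0 : R[i]) (r M : R) a b :
  0 < r -> 0 <= M -> (forall s t, cabs (g s - g t) <= `|s - t|) ->
  (forall t, a <= t <= b -> ccont F (g t)) ->
  (forall t, a <= t <= b -> ccont k' (g t)) ->
  (forall z t, cabs (z - z0) < r -> a <= t <= b -> ccont (k z) (g t)) ->
  (forall z t, cabs (z - z0) < r -> a <= t <= b ->
    cabs (k z (g t) - k z0 (g t) - k' (g t) * (z - z0)) <= M * cabs (z - z0) ^+ 2) ->
  cder (fun z => cint a b (fun t => F (g t) * k z (g t))) z0
    (cint a b (fun t => F (g t) * k' (g t))).
Proof.
move=> r0 M0 lg cF ck' ck kM; apply/cderP => e e0.
pose I := \int[mu]_(t in `[a, b]) cabs (F (g t)).
have I0 : 0 <= I by apply: Rintegral_ge0 => t _; exact: cabs_ge0.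
have K0 : 0 < M * I + 1 by rewrite ltr_wpDl// mulr_ge0.
have c1 G : (forall t, a <= t <= b -> ccont G (g t)) ->
    forall t, a <= t <= b -> ccurve (fun t => F (g t) * G (g t)) t.
  move=> cG t tab; apply: (@ccurve_comp _ (fun w => F w * G w)) => [s|]; first exact: lg.
  by apply: ccontM; [exact: cF|exact: cG].
exists (Num.min r (e / (M * I + 1))); first by rewrite lt_min r0 divr_gt0.
move=> w; rewrite lt_min => /andP[wr we].
have cz0 : cabs (z0 - z0) < r by rewrite subrr ComplexField.Normc.normc0.
have i1 := ccurve_cintegrable (c1 _ (fun t => ck w t wr)).
have i2 := ccurve_cintegrable (c1 _ (fun t => ck z0 t cz0)).
have i3 := ccurve_cintegrable (c1 _ ck').
rewrite -cintB// [_ * (w - z0)]mulrC -cintZ// -cintB//; last 2 first.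
- by apply: cintegrableD => //; under eq_fun do rewrite -mulN1r; exact: cintegrableZ.
- exact: cintegrableZ.
rewrite (@eq_cint _ _ _ _ (fun t => F (g t) * (k w (g t) - k z0 (g t) - k' (g t) * (w
    - z0)))); last first.
  by move=> t _; ring.
have cc : forall t, a <= t <= b ->
    ccurve (fun t => F (g t) * (k w (g t) - k z0 (g t) - k' (g t) * (w - z0))) t.
  apply: c1 (fun u => k w u - k z0 u - k' u * (w - z0)) _ => t tab.
  rewrite (_ : (fun u => _) = fun u => (k w u + (-1) * k z0 u) + k' u * (- (w - z0))).
    apply: ccontD; first apply: ccontD; first exact: ck.
      by apply: ccontM; [exact: ccont_cst|exact: ck].
    by apply: ccontM; [exact: ck'|exact: ccont_cst].
  by apply/funext => u; ring.
rewrite (le_trans (cint_norm cc))//.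
have iF := ccurve_integrable cabs_lip (fun t tab => ccurve_comp (fun s => lg s t) (cF
    t tab)).
apply: (@le_trans _ _ (\int[mu]_(t in `[a, b]) (M * cabs (w - z0) ^+ 2 * cabs (F (g
    t))))).
  apply: le_Rintegral => //.
  - exact: ccurve_integrable cabs_lip cc.
  - exact: RintegrableZ.
  by move=> t tab; rewrite cabsM mulrC ler_wpM2r ?cabs_ge0//; exact: kM.
rewrite RintegralZl// -/I mulrAC expr2 mulrA ler_wpM2r ?cabs_ge0//.
rewrite (@le_trans _ _ ((M * I + 1) * cabs (w - z0)))//.
  by rewrite ler_wpM2r ?cabs_ge0// lerDl.
by rewrite mulrC -ler_pdivlMr// ltW.
Qed.

Lemma cder_rint F (k : R[i] -> R[i] -> R[i]) (k' : R[i] -> R[i])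
    (z0 : R[i]) (r M : R) a b c d : a <= b -> c <= d ->
  0 < r -> 0 <= M -> bcont F a b c d -> bcont k' a b c d ->
  (forall z, cabs (z - z0) < r -> bcont (k z) a b c d) ->
  (forall z x y, cabs (z - z0) < r -> on_boundary a b c d x y ->
    cabs (k z (x +i* y) - k z0 (x +i* y) - k' (x +i* y) * (z - z0)) <= M * cabs (z -
        z0) ^+ 2) ->
  cder (fun z => rint (fun w => F w * k z w) a b c d) z0
    (rint (fun w => F w * k' w) a b c d).
Proof.
move=> ab cd r0 M0 cF ck' ck kM; rewrite /rint /hseg /vseg.
have [ob1 ob2 ob3 ob4] := on_boundary_sides ab cd.
apply: cderD; first (apply: cderB); last (apply: cderZ; apply: cderB).
- apply: (@cder_cint F (fun x => x +i* c) k k' z0 r M) => //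
    [s t|t tab|t tab|z t zr tab|z t zr tab];
    [exact: hline_lip|exact/cF/ob1|exact/ck'/ob1|exact/ck/ob1|exact/kM/ob1].
- apply: (@cder_cint F (fun x => x +i* d) k k' z0 r M) => //
    [s t|t tab|t tab|z t zr tab|z t zr tab];
    [exact: hline_lip|exact/cF/ob2|exact/ck'/ob2|exact/ck/ob2|exact/kM/ob2].
- apply: (@cder_cint F (fun y => b +i* y) k k' z0 r M) => //
    [s t|t tab|t tab|z t zr tab|z t zr tab];
    [exact: vline_lip|exact/cF/ob4|exact/ck'/ob4|exact/ck/ob4|exact/kM/ob4].
- apply: (@cder_cint F (fun y => a +i* y) k k' z0 r M) => //
    [s t|t tab|t tab|z t zr tab|z t zr tab];
    [exact: vline_lip|exact/cF/ob3|exact/ck'/ob3|exact/ck/ob3|exact/kM/ob3].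
Qed.

End CauchyKernel.

(** * Holomorphy of the derivative *)

Section DerivativeHolomorphic.
Context {R : realType}.
Implicit Types (a b c d e x y r s t M : R) (F G f : R[i] -> R[i]) (z w h : R[i]).

Lemma half_dist z w h s : s <= cabs z -> cabs h < s / 2 -> s / 2 <= cabs (z - h).
Proof. by move=> sz hs; have := cabsB_ge z h; lra. Qed.

(** Here [z] stands for w - z0 with w on the boundary, and [h] for the displacement of the pole; the
    remainder is exactly h^2 / (z^2 (z - h)), with |z - h| >= s / 2. *)
Lemma kernel1_taylor z h s : 0 < s -> s <= cabs z -> cabs h < s / 2 ->
  cabs ((z - h)^-1 - z^-1 - (z^-1) ^+ 2 * h) <= 2 / s ^+ 3 * cabs h ^+ 2.
Proof.
move=> s0 sz hs; have zh := half_dist z sz hs.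
have z0 : z != 0 by rewrite -cabs_gt0; lra.
have zh0 : z - h != 0 by rewrite -cabs_gt0; lra.
rewrite (_ : _ - _ = h ^+ 2 / (z ^+ 2 * (z - h))); last by field; rewrite z0 zh0.
rewrite !(cabsM, cabsV, cabsX) mulrC ler_wpM2r ?sqr_ge0//.
rewrite ler_pdivlMr ?exprn_gt0// mulrC ler_pdivrMr;
    last by rewrite mulr_gt0 ?exprn_gt0 ?cabs_gt0.
rewrite [leLHS](_ : _ = 2 * (s ^+ 2 * (s / 2))); last by field.
rewrite ler_pM2l// ler_pM ?exprn_ge0//; try lra.
by rewrite ler_pXn2r// nnegrE; lra.
Qed.

Lemma kernel2_taylor z h s : 0 < s -> s <= cabs z -> cabs h < s / 2 ->
  cabs (((z - h)^-1) ^+ 2 - (z^-1) ^+ 2 - (2 * (z^-1) ^+ 3) * h) <= 8 / s ^+ 4 * cabs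
      h ^+ 2.
Proof.
move=> s0 sz hs; have zh := half_dist z sz hs.
have z0 : z != 0 by rewrite -cabs_gt0; lra.
have zh0 : z - h != 0 by rewrite -cabs_gt0; lra.
rewrite (_ : _ - _ = h ^+ 2 * ((3 * (z - h) + h) / (z - h)) / (z ^+ 3 * (z - h)));
    last first.
  by field; rewrite z0 zh0.
(* The fraction is 3 + h / (z - h), and |h| < s / 2 <= |z - h|. *)
have num : cabs ((3 * (z - h) + h) / (z - h)) <= 4.
  rewrite cabsM cabsV ler_pdivrMr ?cabs_gt0// (le_trans (cabsD _ _))// cabsM.
  have -> : cabs (3 : R[i]) = 3.
    by rewrite -[3 in LHS](rmorph_nat (real_complex R)) cabs_real normr_nat.
  lra.
move: num; move: (_ / (z - h)) => q num.
rewrite !(cabsM, cabsV, cabsX) -mulrA mulrC ler_wpM2r ?sqr_ge0//.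
rewrite ler_pdivrMr; last by rewrite mulr_gt0 ?exprn_gt0 ?cabs_gt0.
rewrite (le_trans num)// mulrAC ler_pdivlMr ?exprn_gt0//.
rewrite [leLHS](_ : _ = 8 * (s ^+ 3 * (s / 2))); last by field.
rewrite ler_pM2l// ler_pM ?exprn_ge0//; try lra.
by rewrite ler_pXn2r// nnegrE; lra.
Qed.

Lemma bcont_kernel_near F a b c d z0 s z n : 0 < s ->
  (forall x y, on_boundary a b c d x y -> s <= cabs ((x +i* y) - z0)) ->
  cabs (z - z0) < s / 2 -> bcont F a b c d ->
  bcont (fun w => F w * ((w - z)^-1) ^+ n) a b c d.
Proof.
move=> s0 sd zs cF x y xy; apply: ccont_kernel; first exact: cF.
have := half_dist (z - z0) (sd _ _ xy) zs.
by rewrite opprB addrA subrK -cabs_gt0; lra.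
Qed.

Lemma cder_cauchy1 F a b c d x0 y0 : a < x0 < b -> c < y0 < d -> bcont F a b c d ->
  cder (fun z => rint (fun w => F w * (w - z)^-1) a b c d) (x0 +i* y0)
    (rint (fun w => F w * (w - (x0 +i* y0))^-1 ^+ 2) a b c d).
Proof.
move=> xab ycd cF; set z0 := x0 +i* y0.
have [s s0 sd] := boundary_radius xab ycd.
have one : bcont (fun=> 1 : R[i]) a b c d by move=> x y _; exact: ccont_cst.
apply: (@cder_rint _ F (fun z w => (w - z)^-1) (fun w => (w - z0)^-1 ^+ 2) z0 (s / 2)
    (2 / s ^+ 3)) => //.
- by lra.
- by lra.
- by rewrite divr_gt0.
- by rewrite divr_ge0// exprn_ge0// ltW.
- rewrite (_ : (fun w => _) = fun w => 1 * ((w - z0)^-1) ^+ 2);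
    last by apply/funext => w; rewrite mul1r.
  exact: bcont_kernel.
- move=> z zs; rewrite (_ : (fun w => _) = fun w => 1 * ((w - z)^-1) ^+ 1);
    last by apply/funext => w; rewrite mul1r.
  exact: bcont_kernel_near sd _ _.
- move=> z x y zs xy; rewrite [_ - z](_ : _ = ((x +i* y) - z0) - (z - z0)); last by ring.
  by apply: kernel1_taylor => //; exact: sd.
Qed.

Lemma cder_cauchy2 F a b c d x0 y0 : a < x0 < b -> c < y0 < d -> bcont F a b c d ->
  cder (fun z => rint (fun w => F w * (w - z)^-1 ^+ 2) a b c d) (x0 +i* y0)
    (rint (fun w => F w * (2 * (w - (x0 +i* y0))^-1 ^+ 3)) a b c d).
Proof.
move=> xab ycd cF; set z0 := x0 +i* y0.
have [s s0 sd] := boundary_radius xab ycd.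
have one k : bcont (fun=> k : R[i]) a b c d by move=> x y _; exact: ccont_cst.
apply: (@cder_rint _ F (fun z w => (w - z)^-1 ^+ 2) (fun w => 2 * (w - z0)^-1 ^+ 3)
    z0 (s / 2) (8 / s ^+ 4)) => //.
- by lra.
- by lra.
- by rewrite divr_gt0.
- by rewrite divr_ge0// exprn_ge0// ltW.
- exact: bcont_kernel.
- move=> z zs; rewrite (_ : (fun w => _) = fun w => 1 * ((w - z)^-1) ^+ 2);
    last by apply/funext => w; rewrite mul1r.
  exact: bcont_kernel_near sd _ _.
- move=> z x y zs xy; rewrite [_ - z](_ : _ = ((x +i* y) - z0) - (z - z0)); last by ring.
  by apply: kernel2_taylor => //; exact: sd.
Qed.

Lemma index_neq0 a b c d x0 y0 : a < x0 < b -> c < y0 < d ->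
  rint (fun w => (w - (x0 +i* y0))^-1) a b c d != 0.
Proof.
move=> xab ycd; apply/eqP => i0.
pose s := Num.min (Num.min (x0 - a) (b - x0)) (Num.min (y0 - c) (d - y0)).
pose t := (b - a) + (d - c).
have s0 : 0 < s by rewrite !lt_min !subr_gt0; case/andP: xab => -> ->;
    case/andP: ycd => -> ->.
have t0 : 0 < t by rewrite /t; lra.
have sh : [/\ s <= x0 - a, s <= b - x0, s <= y0 - c & s <= d - y0].
  by split; rewrite !ge_min lexx ?orbT.
case: sh => h1 h2 h3 h4.
have := @index_ge _ a b c d x0 y0 s t s0.
rewrite i0 h1 h2 h3 h4 /= => H.
have {H} : 4 * (s ^+ 2 / t ^+ 2) <= 0 by apply: H; rewrite /t; lra.
by apply/negP; rewrite -ltNge mulr_gt0// divr_gt0 ?exprn_gt0.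
Qed.

(** Near [z0], Cauchy's formula reads f = N / I with [I] nonzero but not evaluated. The quotient
    rule and uniqueness of the derivative give f' = (N2 I - N I2) / I^2, in which every factor is
    again differentiable. *)
Lemma cder_derivative f (f' : R[i] -> R[i]) z0 r : 0 < r ->
  (forall z, cabs (z - z0) < r -> cder f z (f' z)) -> exists D, cder f' z0 D.
Proof.
case: z0 => x0 y0 r0 df.
(* [r / 3] puts the whole square inside the disc: its points satisfy |x - x0| + |y - y0| <= 2 r /
   3. *)
pose h := r / 3; have h0 : 0 < h by rewrite divr_gt0.
pose a := x0 - h; pose b := x0 + h; pose c := y0 - h; pose d := y0 + h.
have rect x y : a <= x <= b -> c <= y <= d -> exists D, cder f (x +i* y) D.
  rewrite /a /b /c /d => hx hy; exists (f' (x +i* y)); apply: df.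
  have k1 : `|x - x0| <= h by rewrite ler_norml; lra.
  have k2 : `|y - y0| <= h by rewrite ler_norml; lra.
  have := cabs_le_ReIm ((x +i* y) - (x0 +i* y0)); rewrite /=.
  by move: k1 k2; rewrite /h; move: r0; lra.
have inside x y : cabs ((x +i* y) - (x0 +i* y0)) < h -> a < x < b /\ c < y < d.
  move=> zh.
  have := le_lt_trans (Re_le_cabs _) zh; have := le_lt_trans (Im_le_cabs _) zh.
  by rewrite /= !ltr_norml /a /b /c /d => *; lra.
have bf : bcont f a b c d.
  by move=> x y [xx yy _]; have [D /cder_cont] := rect _ _ xx yy.
have one : bcont (fun=> 1 : R[i]) a b c d by move=> x y _; exact: ccont_cst.
pose N z := rint (fun w => f w * (w - z)^-1) a b c d.
pose N2 z := rint (fun w => f w * (w - z)^-1 ^+ 2) a b c d.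
(* The factor [1] makes this the Cauchy integral of a constant, so that [cder_cauchy1] and
   [cder_cauchy2] serve [I] as well as [N]. *)
pose I z := rint (fun w => 1 * (w - z)^-1) a b c d.
pose I2 z := rint (fun w => 1 * (w - z)^-1 ^+ 2) a b c d.
have IE z : I z = rint (fun w => (w - z)^-1) a b c d.
  by rewrite /I; under eq_fun do rewrite mul1r.
have I0 z : cabs (z - (x0 +i* y0)) < h -> I z != 0.
  by case: z => x y /inside[xx yy]; rewrite IE index_neq0.
have f'E z : cabs (z - (x0 +i* y0)) < h ->
    f' z = (N2 z * I z - N z * I2 z) / I z ^+ 2.
  case: z => x y zh; have [xx yy] := inside _ _ zh.
  have d1 := cder_div (cder_cauchy1 xx yy bf) (cder_cauchy1 xx yy one) (I0 _ zh).
  apply: cder_unique (d1); apply: cder_near (df _ _); last first.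
    by rewrite (lt_trans zh)// /h; lra.
  exists (h - cabs ((x +i* y) - (x0 +i* y0))); first by rewrite subr_gt0.
  move=> -[u v] wz; have wh : cabs ((u +i* v) - (x0 +i* y0)) < h.
    by rewrite (le_lt_trans (cabs_distD (x +i* y) _ _))//; lra.
  have [uu vv] := inside _ _ wh.
  rewrite -/(N _) -/(I _); have := cauchy_formula uu vv rect.
  by rewrite -/(N _) -IE => ->; rewrite mulfK// I0.
have z0h : cabs ((x0 +i* y0) - (x0 +i* y0)) < h by rewrite subrr
    ComplexField.Normc.normc0.
have [xx yy] := inside _ _ z0h.
have dN := cder_cauchy1 xx yy bf; have dI := cder_cauchy1 xx yy one.
have dN2 := cder_cauchy2 xx yy bf; have dI2 := cder_cauchy2 xx yy one.
have I20 : I (x0 +i* y0) * I (x0 +i* y0) != 0 by rewrite mulf_neq0// I0.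
eexists; apply: cder_near (cder_div (cderB (cderM dN2 dI) (cderM dN dI2)) (cderM dI
    dI) I20).
by exists h => // w wh; rewrite f'E// expr2.
Qed.

Lemma analytic_cder f z : analytic_on_disc f -> unit_disc z ->
  cder f z (@derive1 R[i] R[i]^o f z).
Proof. by move=> af /af; exact: derivable_cder. Qed.

Lemma cder_derive1 f z : analytic_on_disc f -> unit_disc z ->
  exists D, cder (@derive1 R[i] R[i]^o f) z D.
Proof.
move=> af zD; apply: (@cder_derivative f _ z (1 - cabs z)).
  by rewrite subr_gt0.
move=> w wz; apply: analytic_cder => //.
rewrite /unit_disc /=; have := cabsB_ge w z; lra.
Qed.

End DerivativeHolomorphic.

(** * Measurability and Tonelli estimates in the plane *)

Section PlaneMeasure.
Context {R : realType}.
Notation mu := (@lebesgue_measure R).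
Notation RR := (measurableTypeR R * measurableTypeR R)%type.
Implicit Types (a b c d e x y r s t M : R).

Definition popen (A : set (R * R)) := forall u, A u -> exists2 r, 0 < r &
  forall v, `|v.1 - u.1| < r -> `|v.2 - u.2| < r -> A v.

(** An open set is the union of the boxes with rational centre and half side that it contains, a
    countable union of measurable rectangles. *)
Lemma popen_measurable (A : set RR) : popen A -> measurable A.
Proof.
move=> oA.
pose box (p q s : rat) : set RR :=
  (`]ratr p - ratr s, ratr p + ratr s[ `*` `]ratr q - ratr s, ratr q + ratr s[)%classic.
have mbox p q k : measurable (box p q k) by apply: measurableX.
rewrite (_ : A = \bigcup_p \bigcup_q \bigcup_k
    if pselect (box p q k `<=` A) then box p q k else set0).
  apply: bigcupT_measurable_rat => p; apply: bigcupT_measurable_rat => q.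
  by apply: bigcupT_measurable_rat => k; case: pselect => ?;
      [exact: mbox|exact: measurable0].
apply/seteqP; split => [u Au|u [p _ [q _ [s _]]]]; last by case: pselect => // H /H.
have [r r0 rA] := oA _ Au.
(* Half of [r], because the rational centre is itself up to [ratr s] away from [u] in each
   coordinate. *)
have [s] := @rat_in_itvoo R 0 (r / 2) ltac:(by rewrite divr_gt0).
rewrite in_itv /= => /andP[s0 sr].
have [p] := @rat_in_itvoo R (u.1 - ratr s) (u.1 + ratr s) ltac:(by lra).
rewrite in_itv /= => /andP[p1 p2].
have [q] := @rat_in_itvoo R (u.2 - ratr s) (u.2 + ratr s) ltac:(by lra).
rewrite in_itv /= => /andP[q1 q2].
exists p => //; exists q => //; exists s => //.
case: pselect => [?|nA]; first by split; rewrite /= in_itv /=; lra.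
exfalso; apply: nA => v [] /=; rewrite !in_itv /= => v1 v2.
by apply: rA; rewrite ltr_norml; lra.
Qed.

Lemma pcont_measurable (D : set RR) (g : RR -> R) : popen D ->
  (forall u, D u -> forall e, 0 < e -> exists2 r, 0 < r & forall v,
     `|v.1 - u.1| < r -> `|v.2 - u.2| < r -> `|g v - g u| <= e) ->
  measurable_fun D g.
Proof.
move=> oD cg; apply: (measurability _ (RGenOInfty.measurableE R)).
move=> _ [_ [x ->] <-]; apply: popen_measurable => u [Du].
rewrite /= in_itv /= andbT => xu.
have [r r0 rD] := oD _ Du.
have [s s0 sg] := cg _ Du ((g u - x) / 2) ltac:(by rewrite divr_gt0// subr_gt0).
exists (Num.min r s); first by rewrite lt_min r0.
move=> v; rewrite !lt_min => /andP[r1 s1] /andP[r2 s2].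
split; first exact: rD.
have := sg v s1 s2; rewrite /= in_itv /= andbT ler_norml; lra.
Qed.

Definition prect a b c d : set RR := (`[a, b] `*` `[c, d])%classic.

Lemma prectP a b c d (u : RR) : (prect a b c d u) = (a <= u.1 <= b /\ c <= u.2 <= d)
    :> Prop.
Proof. by rewrite /prect /= /setX /= !in_itv. Qed.

Lemma measurable_prect a b c d : measurable (prect a b c d).
Proof. by apply: measurableX. Qed.

(** Tonelli with the inner integral along vertical lines; lines outside the strip are discarded, the
    integrand being nonnegative. *)
Lemma ge_integral_vstrip a b c d s t M (g : RR -> R) : 0 <= M ->
  a <= s -> s <= t -> t <= b -> (forall u, 0 <= g u) ->
  measurable_fun (prect a b c d) g ->
  (forall x, s <= x <= t -> (M%:E <= \int[mu]_(y in `[c, d]) (g (x, y))%:E)%E) ->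
  ((M * (t - s))%:E <= \int[mu \x mu]_(u in prect a b c d) (g u)%:E)%E.
Proof.
move=> M0 as_ st tb g0 mg gM.
have mQ := measurable_prect a b c d.
pose G := ((EFin \o g) \_ (prect a b c d))%E.
have G0 u : (0 <= G u)%E by apply: erestrict_ge0 => v _; rewrite lee_fin.
have mEg : measurable_fun (prect a b c d) (EFin \o g) by apply/measurable_EFinP.
have mG : measurable_fun setT G := (measurable_restrictT (EFin \o g) mQ).1 mEg.
rewrite integral_mkcond fubini_tonelli1//.
apply: (@le_trans _ _ (\int[mu]_(x in `[s, t]) (cst M%:E x))%E).
  rewrite integral_cst//= lebesgue_measure_itv /= lte_fin.
  have [st1|ts] := ltP s t; first by rewrite EFinM.
  by have -> : t = s; [apply/eqP; rewrite eq_le st ts|rewrite subrr mulr0 mule0].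
apply: (@le_trans _ _ (\int[mu]_(x in `[s, t]) fubini_F mu G x)%E).
  apply: ge0_le_integral => //.
  - by apply: measurable_funTS; apply: measurable_fun_fubini_tonelli_F.
  move=> x; rewrite /= in_itv /= => xst; rewrite (le_trans (gM x xst))//.
  rewrite le_eqVlt; apply/orP/or_introl/eqP; rewrite integral_mkcond.
  apply: eq_integral => y _; rewrite /G !patchE; congr (if _ then _ else _).
  apply/idP/idP; rewrite !inE prectP /= !in_itv /=.
    by move=> ycd; split=> //; lra.
  by case.
apply: ge0_subset_integral => //.
  by apply: measurable_fun_fubini_tonelli_F.
by move=> x _; apply: integral_ge0.
Qed.

Lemma ge_integral_hstrip a b c d s t M (g : RR -> R) : 0 <= M ->
  c <= s -> s <= t -> t <= d -> (forall u, 0 <= g u) ->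
  measurable_fun (prect a b c d) g ->
  (forall y, s <= y <= t -> (M%:E <= \int[mu]_(x in `[a, b]) (g (x, y))%:E)%E) ->
  ((M * (t - s))%:E <= \int[mu \x mu]_(u in prect a b c d) (g u)%:E)%E.
Proof.
move=> M0 as_ st tb g0 mg gM.
have mQ := measurable_prect a b c d.
pose G := ((EFin \o g) \_ (prect a b c d))%E.
have G0 u : (0 <= G u)%E by apply: erestrict_ge0 => v _; rewrite lee_fin.
have mEg : measurable_fun (prect a b c d) (EFin \o g) by apply/measurable_EFinP.
have mG : measurable_fun setT G := (measurable_restrictT (EFin \o g) mQ).1 mEg.
rewrite integral_mkcond fubini_tonelli2//.
apply: (@le_trans _ _ (\int[mu]_(x in `[s, t]) (cst M%:E x))%E).
  rewrite integral_cst//= lebesgue_measure_itv /= lte_fin.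
  have [st1|ts] := ltP s t; first by rewrite EFinM.
  by have -> : t = s; [apply/eqP; rewrite eq_le st ts|rewrite subrr mulr0 mule0].
apply: (@le_trans _ _ (\int[mu]_(y in `[s, t]) fubini_G mu G y)%E).
  apply: ge0_le_integral => //.
  - by apply: measurable_funTS; apply: measurable_fun_fubini_tonelli_G.
  move=> y; rewrite /= in_itv /= => yst; rewrite (le_trans (gM y yst))//.
  rewrite le_eqVlt; apply/orP/or_introl/eqP; rewrite integral_mkcond.
  apply: eq_integral => x _; rewrite /G !patchE; congr (if _ then _ else _).
  apply/idP/idP; rewrite !inE prectP /= !in_itv /=.
    by move=> xab; split=> //; lra.
  by case.
apply: ge0_subset_integral => //.
  by apply: measurable_fun_fubini_tonelli_G.
by move=> x _; apply: integral_ge0.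
Qed.

End PlaneMeasure.

(** * Bounding a value by an area integral *)

Section AreaEstimate.
Context {R : realType}.
Notation mu := (@lebesgue_measure R).
Notation RR := (measurableTypeR R * measurableTypeR R)%type.
Implicit Types (a b c d e x y r s t M : R) (F G f : R[i] -> R[i]).

Lemma Rintegral_itv_subset a b c d (g : R -> R) : a <= c -> c <= d -> d <= b ->
  mu.-integrable `[a, b] (EFin \o g) -> (forall t, 0 <= g t) ->
  \int[mu]_(t in `[c, d]) g t <= \int[mu]_(t in `[a, b]) g t.
Proof.
move=> ac cd db gi g0.
have gi' : mu.-integrable `[c, b] (EFin \o g).
  by apply: integrableS gi => //; apply: subset_itvr; rewrite bnd_simp.
have h1 : a <= c <= b by rewrite ac (le_trans cd).
have h2 : c <= d <= b by rewrite cd db.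
rewrite (Rintegral_itv_split h1 gi) (Rintegral_itv_split h2 gi').
rewrite addrCA lerDl addr_ge0//; exact: Rintegral_ge0.
Qed.

Lemma cint_kernel_le a b c d M (g k : R -> R[i]) : a <= c -> c <= d -> d <= b -> 0 <= M ->
  (forall t, a <= t <= b -> ccurve g t) ->
  (forall t, c <= t <= d -> ccurve (fun t => g t * k t) t) ->
  (forall t, c <= t <= d -> cabs (k t) <= M) ->
  cabs (cint c d (fun t => g t * k t)) <= M * \int[mu]_(t in `[a, b]) cabs (g t).
Proof.
move=> ac cd db M0 cg cgk kM; rewrite (le_trans (cint_norm cgk))//.
have gi := ccurve_integrable cabs_lip cg.
have gi' : mu.-integrable `[c, d] (EFin \o (fun t => cabs (g t))).
  apply: (ccurve_integrable cabs_lip) => t /andP[ct td].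
  by apply: cg; rewrite (le_trans ac)// (le_trans td).
apply: (@le_trans _ _ (\int[mu]_(t in `[c, d]) (M * cabs (g t)))).
  apply: le_Rintegral => //; first exact: (ccurve_integrable cabs_lip).
    exact: RintegrableZ.
  by move=> t tcd; rewrite cabsM mulrC ler_wpM2r ?cabs_ge0//; exact: kM.
rewrite RintegralZl// ler_wpM2l//; apply: Rintegral_itv_subset => // t; exact: cabs_ge0.
Qed.

(** The integrals on the right run over the full ranges [[A, B]] and [[C, D]], so each of the four
    terms depends on the position of one side only. This lets the four sides be chosen
    independently. *)
Lemma rint_kernel_le f x0 y0 a b c d A B C D h : 0 < h ->
  A <= a <= x0 - h -> x0 + h <= b <= B -> C <= c <= y0 - h -> y0 + h <= d <= D ->
  rcont f A B C D ->
  h * cabs (rint (fun w => f w * (w - (x0 +i* y0))^-1) a b c d) <=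
  (\int[mu]_(x in `[A, B]) cabs (f (x +i* c)) + \int[mu]_(x in `[A, B]) cabs (f (x
      +i* d))) +
  (\int[mu]_(y in `[C, D]) cabs (f (b +i* y)) + \int[mu]_(y in `[C, D]) cabs (f (a
      +i* y))).
Proof.
move=> h0 ha hb hc hd cf.
have ab : a <= b by lra.
have cd : c <= d by lra.
have xab : a < x0 < b by lra.
have ycd : c < y0 < d by lra.
have bf : bcont f a b c d by move=> x y [hx hy _]; apply: cf; lra.
have bk : bcont (fun w => f w * (w - (x0 +i* y0))^-1) a b c d.
  move=> x y xy; apply: ccontM; [exact: bf|exact: (bcont_inv xab ycd)].
have kM x y : on_boundary a b c d x y -> cabs ((x +i* y) - (x0 +i* y0))^-1 <= h^-1.
  move=> xy; have hd' : h <= cabs ((x +i* y) - (x0 +i* y0)) by apply: boundary_dist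
      xy; lra.
  by rewrite cabsV lef_pV2// posrE (lt_le_trans h0).
have [ob1 ob2 ob3 ob4] := on_boundary_sides ab cd.
have hV0 : 0 <= h^-1 by rewrite invr_ge0 ltW.
rewrite mulrC -ler_pdivlMr// mulrC !mulrDr /rint.
rewrite (le_trans (cabsD _ _))// lerD// ?cabsM ?cabs_imag ?normr1 ?mul1r.
- rewrite (le_trans (cabsB _ _))// lerD//.
  + apply: (@cint_kernel_le A B a b _ (fun x => f (x +i* c)) (fun x => ((x +i* c) -
      (x0 +i* y0))^-1)) => //; try lra.
    * by apply: hcurve => x hx; apply: cf => //; lra.
    * by apply: (@hcurve _ (fun w => f w * (w - (x0 +i* y0))^-1)) => x hx; exact/bk/ob1.
    * by move=> x hx; exact/kM/ob1.
  + apply: (@cint_kernel_le A B a b _ (fun x => f (x +i* d)) (fun x => ((x +i* d) -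
      (x0 +i* y0))^-1)) => //; try lra.
    * by apply: hcurve => x hx; apply: cf => //; lra.
    * by apply: (@hcurve _ (fun w => f w * (w - (x0 +i* y0))^-1)) => x hx; exact/bk/ob2.
    * by move=> x hx; exact/kM/ob2.
- rewrite (le_trans (cabsB _ _))// lerD//.
  + apply: (@cint_kernel_le C D c d _ (fun y => f (b +i* y)) (fun y => ((b +i* y) -
      (x0 +i* y0))^-1)) => //; try lra.
    * by apply: vcurve => y hy; apply: cf => //; lra.
    * by apply: (@vcurve _ (fun w => f w * (w - (x0 +i* y0))^-1)) => y hy; exact/bk/ob4.
    * by move=> y hy; exact/kM/ob4.
  + apply: (@cint_kernel_le C D c d _ (fun y => f (a +i* y)) (fun y => ((a +i* y) -
      (x0 +i* y0))^-1)) => //; try lra.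
    * by apply: vcurve => y hy; apply: cf => //; lra.
    * by apply: (@vcurve _ (fun w => f w * (w - (x0 +i* y0))^-1)) => y hy; exact/bk/ob3.
    * by move=> y hy; exact/kM/ob3.
Qed.

(* Cauchy's formula holds on every rectangle whose four sides lie in the four
   strips between distance r/2 and r from the centre, so one of the four
   families of sides carries at least a quarter of the bound throughout. *)
Lemma area_estimate f x0 y0 r : 0 < r ->
  (forall x y, x0 - r <= x <= x0 + r -> y0 - r <= y <= y0 + r -> exists D, cder f (x
      +i* y) D) ->
  measurable_fun (prect (x0 - r) (x0 + r) (y0 - r) (y0 + r))
    (fun u : RR => cabs (f (u.1 +i* u.2))) ->
  ((r ^+ 2 / 16 * cabs (f (x0 +i* y0)))%:E <=
   \int[mu \x mu]_(u in prect (x0 - r) (x0 + r) (y0 - r) (y0 + r))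
     (cabs (f (u.1 +i* u.2)))%:E)%E.
Proof.
move=> r0 df mf.
pose A := x0 - r; pose B := x0 + r; pose C := y0 - r; pose D := y0 + r; pose h := r / 2.
have h0 : 0 < h by rewrite divr_gt0.
have hr : r = 2 * h by rewrite /h; field.
have cf : rcont f A B C D.
  by move=> x y hx hy; have [E /cder_cont] := df _ _ hx hy.
pose H y := \int[mu]_(x in `[A, B]) cabs (f (x +i* y)).
pose V x := \int[mu]_(y in `[C, D]) cabs (f (x +i* y)).
pose m := h * cabs (f (x0 +i* y0)).
have m0 : 0 <= m / 4 by rewrite divr_ge0// mulr_ge0 ?cabs_ge0// ltW.
have main a b c d : A <= a <= x0 - h -> x0 + h <= b <= B ->
    C <= c <= y0 - h -> y0 + h <= d <= D -> m <= (H c + H d) + (V b + V a).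
  move=> ha hb hc hd; apply: le_trans (rint_kernel_le h0 ha hb hc hd cf).
  rewrite /A /B /C /D in ha hb hc hd.
  rewrite cauchy_formula; [|lra|lra|by move=> x y hx hy; apply: df; lra].
  rewrite cabsM mulrA ler_peMr//; first by rewrite mulr_ge0 ?cabs_ge0// ltW.
  rewrite (le_trans _ (Im_le_cabs _))// (le_trans _ (ler_norm _))//.
  rewrite (le_trans _ (@index_ge _ a b c d x0 y0 h r h0 _ _ _ _))//; try lra.
  by rewrite hr le_eqVlt; apply/orP/or_introl/eqP; field; rewrite gt_eqF.
(* The level [m / 4] times the width [h] of a strip. *)
have val : r ^+ 2 / 16 * cabs (f (x0 +i* y0)) = m / 4 * h.
  by rewrite hr /m; field.
have HE y : C <= y <= D -> (H y)%:E = (\int[mu]_(x in `[A, B]) (cabs (f (x +i* y)))%:E)%E.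
  move=> hy; rewrite fineK//; apply: integrable_fin_num => //.
  apply: (ccurve_integrable cabs_lip); apply: hcurve => x hx; exact: cf.
have VE x : A <= x <= B -> (V x)%:E = (\int[mu]_(y in `[C, D]) (cabs (f (x +i* y)))%:E)%E.
  move=> hx; rewrite fineK//; apply: integrable_fin_num => //.
  apply: (ccurve_integrable cabs_lip); apply: vcurve => y hy; exact: cf.
have g0 (u : RR) : 0 <= cabs (f (u.1 +i* u.2)) by exact: cabs_ge0.
have hstrip s t : t - s = h -> C <= s -> t <= D ->
    (forall y, s <= y <= t -> m / 4 <= H y) ->
    ((r ^+ 2 / 16 * cabs (f (x0 +i* y0)))%:E <=
     \int[mu \x mu]_(u in prect A B C D) (cabs (f (u.1 +i* u.2)))%:E)%E.
  move=> ts Cs tD mH; rewrite val -ts; apply: ge_integral_hstrip => //; first lra.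
  move=> y hy /=; rewrite -HE ?lee_fin ?mH//; lra.
have vstrip s t : t - s = h -> A <= s -> t <= B ->
    (forall x, s <= x <= t -> m / 4 <= V x) ->
    ((r ^+ 2 / 16 * cabs (f (x0 +i* y0)))%:E <=
     \int[mu \x mu]_(u in prect A B C D) (cabs (f (u.1 +i* u.2)))%:E)%E.
  move=> ts Cs tD mH; rewrite val -ts; apply: ge_integral_vstrip => //; first lra.
  move=> x hx /=; rewrite -VE ?lee_fin ?mH//; lra.
(* A strip on which the level [m / 4] is not reached throughout supplies a line below it; four such
   lines, one per strip, contradict [main]. *)
have dich (P : R -> R) s t : (forall y, s <= y <= t -> m / 4 <= P y) \/
    exists2 y, s <= y <= t & P y < m / 4.
  have [|] := pselect (exists2 y, s <= y <= t & P y < m / 4); first by right.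
  move=> nP; left => y yst; rewrite leNgt; apply/negP => Py.
  by apply: nP; exists y.
have [|[a ha Va]] := dich V A (x0 - h); first by apply: vstrip; rewrite /A /B; lra.
have [|[b hb Vb]] := dich V (x0 + h) B; first by apply: vstrip; rewrite /A /B; lra.
have [|[c hc Hc]] := dich H C (y0 - h); first by apply: hstrip; rewrite /C /D; lra.
have [|[d hd Hd]] := dich H (y0 + h) D; first by apply: hstrip; rewrite /C /D; lra.
by exfalso; have := main a b c d ha hb hc hd; lra.
Qed.

End AreaEstimate.

(** * Point evaluation, part (i) *)

Section PointEvaluation.
Context {R : realType}.
Notation mu := (@lebesgue_measure R).
Notation RR := (measurableTypeR R * measurableTypeR R)%type.
Implicit Types (a b c d e x y r s t M p : R) (f : R[i] -> R[i]).

Definition pdisc : set RR := [set u : RR | unit_disc (u.1 +i* u.2)].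

Lemma pt_dist_le (u v : RR) :
  cabs ((u.1 +i* u.2) - (v.1 +i* v.2)) <= `|u.1 - v.1| + `|u.2 - v.2|.
Proof. exact: cabs_le_ReIm. Qed.

Lemma popen_pdisc : popen pdisc.
Proof.
move=> u Du; have h : 0 < (1 - cabs (u.1 +i* u.2)) / 2 by rewrite divr_gt0// subr_gt0.
exists ((1 - cabs (u.1 +i* u.2)) / 2) => // v v1 v2; rewrite /pdisc /unit_disc /=.
have := pt_dist_le v u; have := cabsB_ge (v.1 +i* v.2) (u.1 +i* u.2); lra.
Qed.

Lemma ccont_measurable f : (forall z, unit_disc z -> ccont f z) ->
  measurable_fun pdisc (fun u : RR => cabs (f (u.1 +i* u.2))).
Proof.
move=> cf; apply: pcont_measurable; first exact: popen_pdisc.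
move=> u Du e e0; have [r r0 fr] := cf _ Du _ e0.
exists (r / 2); first by rewrite divr_gt0.
move=> v v1 v2; rewrite (le_trans (cabs_lip _ _))//; apply: fr.
by rewrite (le_lt_trans (pt_dist_le v u))//; lra.
Qed.

Lemma measurable_weight (D : set RR) : popen D ->
  measurable_fun D (fun u : RR => phi_weight (u.1 +i* u.2)).
Proof.
move=> oD; apply: pcont_measurable => // u _ e e0; exists e => // v v1 _.
rewrite /phi_weight /= opprD addrACA subrr add0r opprK addrC.
by rewrite (le_trans (ler_dist_dist _ _))// distrC ltW.
Qed.

(** Up to the level [s] the first term suffices; above it t / s >= 1, and raising to the power [p]
    only increases it. *)
Lemma le_powR_shift p s t : 1 <= p -> 0 < s -> 0 <= t -> t <= s + s * (t / s) `^ p.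
Proof.
move=> p1 s0 t0; have [ts|st] := leP t s.
  by rewrite (le_trans ts)// lerDl mulr_ge0 ?powR_ge0// ltW.
rewrite (@le_trans _ _ (s * (t / s) `^ p))//; last by rewrite lerDr ltW.
rewrite mulrC -ler_pdivrMr// le1r_powR//.
by rewrite ler_pdivlMr// mul1r ltW.
Qed.

Lemma le_powR_root p s X : 1 <= p -> 0 <= s -> s `^ p <= X -> s <= X `^ p^-1.
Proof.
move=> p1 s0 sX; have p0 : p != 0 by rewrite gt_eqF// (lt_le_trans ltr01).
rewrite -[leLHS](powRr1 s0) -(divff p0) powRrM ge0_ler_powR//.
- by rewrite invr_ge0 (le_trans ler01).
- by rewrite nnegrE powR_ge0.
- by rewrite nnegrE (le_trans _ sX)// powR_ge0.
Qed.

(** [bergman_norm] reads the integral through [fine], which sends [+oo] to [0]; membership in the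
    space excludes this default. *)
Lemma disc_integral_fin p f : 1 <= p -> bergman_space phi_weight p f ->
  0 <= fine (bergman_integral phi_weight p f) /\
  (\int[mu \x mu]_(u in pdisc) (cabs (f (u.1 +i* u.2)) `^ p * phi_weight (u.1 +i*
      u.2))%:E)%E =
  (pi * fine (bergman_integral phi_weight p f))%:E.
Proof.
move=> p1 [_ fin].
set J := (\int[mu \x mu]_(u in pdisc) _)%E.
have J0 : (0 <= J)%E.
  apply: integral_ge0 => u Du; rewrite lee_fin mulr_ge0 ?powR_ge0//.
  by rewrite /phi_weight subr_ge0 (le_trans (Re_le_cabs _))// ltW.
have bE : bergman_integral phi_weight p f = ((pi^-1)%:E * J)%E by [].
have b0 : (0 <= bergman_integral phi_weight p f)%E.
  by rewrite bE mule_ge0// lee_fin invr_ge0 pi_ge0.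
split; first exact: fine_ge0.
rewrite EFinM fineK ?ge0_fin_numE// bE muleA -EFinM divff ?mul1e//.
by rewrite gt_eqF// pi_gt0.
Qed.

Lemma measure_square x y r : 0 < r ->
  ((mu \x mu) (prect (x - r) (x + r) (y - r) (y + r)) = (4 * r ^+ 2)%:E)%E.
Proof.
move=> r0; rewrite /prect product_measure1E//=.
rewrite !lebesgue_measure_itv /= !lte_fin !ifT; [|lra|lra].
by rewrite -!EFinD -EFinM; congr EFin; ring.
Qed.

Lemma point_evaluation_pow p f z : 1 <= p -> bergman_space phi_weight p f ->
  unit_disc z ->
  (cabs (f z) / 128) `^ p * ((1 - cabs z) ^+ 2 * (1 - `|complex.Re z|)) <=
  8 * pi * fine (bergman_integral phi_weight p f).
Proof.
case: z => x0 y0 p1 Bf zD; set z := x0 +i* y0.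
have p0 : 0 < p by rewrite (lt_le_trans ltr01).
have [W0 JE] := disc_integral_fin p1 Bf.
have [af _] := Bf; set W := fine _ in W0 JE *.
have zl : 0 < 1 - cabs z by rewrite subr_gt0.
have xz : `|x0| <= cabs z by have := Re_le_cabs z.
have w0 : 0 < 1 - `|x0| by lra.
rewrite [complex.Re z]/=.
set m := cabs (f z).
have [m0|mgt] := leP m 0.
  have -> : m = 0 by apply/eqP; rewrite eq_le m0 cabs_ge0.
  rewrite mul0r powR0 ?gt_eqF// mul0r !mulr_ge0// pi_ge0//.
(* The area estimate gives r^2 / 16 * m = 8 r^2 s, while the constant [s] integrates to 4 r^2 s over
   the square: half is absorbed and half remains. The existential keeps [s], and later [K], opaque
   to [ring] and [field]. *)
have [s sE] : exists s, s = m / 128 by eexists.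
have s0 : 0 < s by rewrite sE divr_gt0.
rewrite -sE.
pose r := (1 - cabs z) / 4; have r0 : 0 < r by rewrite divr_gt0.
pose Q := prect (x0 - r) (x0 + r) (y0 - r) (y0 + r).
have mQ : measurable Q by exact: measurable_prect.
(* Points of the square are within 2 r = (1 - |z|) / 2 of [z], and their real parts within r <= (1 -
   |x0|) / 4 of [x0]. *)
have near x y : x0 - r <= x <= x0 + r -> y0 - r <= y <= y0 + r ->
    unit_disc (x +i* y) /\ (1 - `|x0|) / 2 <= phi_weight (x +i* y).
  move=> hx hy.
  have k1 : `|x - x0| <= r by rewrite ler_norml; lra.
  have k2 : `|y - y0| <= r by rewrite ler_norml; lra.
  have d := @pt_dist_le (x, y) (x0, y0); rewrite /= in d.
  have k3 := cabsB_ge (x +i* y) z.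
  split; first by rewrite /unit_disc /=; move: d k1 k2 k3; rewrite /r -/z; lra.
  rewrite /phi_weight /=; have := ler_normB x x0; have := lerB_dist x x0.
  by move: k1; rewrite /r; lra.
have QD : Q `<=` pdisc.
  by move=> u; rewrite /Q prectP => -[hx hy]; have [] := near _ _ hx hy.
have cf w : unit_disc w -> ccont f w by move=> /(analytic_cder af)/cder_cont.
have mfD := ccont_measurable cf.
have mD : measurable pdisc by apply: popen_measurable; exact: popen_pdisc.
have mfQ : measurable_fun Q (fun u : RR => cabs (f (u.1 +i* u.2))).
  exact: measurable_funS mfD.
pose G (u : RR) := cabs (f (u.1 +i* u.2)) `^ p * phi_weight (u.1 +i* u.2).
have mGD : measurable_fun pdisc G.
  apply: measurable_funM; last by apply: measurable_weight; exact: popen_pdisc.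
  exact: (measurableT_comp (measurable_powR p) mfD).
have mGQ : measurable_fun Q G by exact: measurable_funS mGD.
have GD0 u : pdisc u -> 0 <= G u.
  move=> Du; rewrite mulr_ge0 ?powR_ge0// /phi_weight subr_ge0.
  by rewrite (le_trans (Re_le_cabs _))// ltW.
(* The factor s^(1 - p) comes from [le_powR_shift]; the factor 2 / (1 - |x0|) makes room for the
   weight, since its product with [phi_weight] is at least 1 on the square. *)
have [K KE] : exists K, K = s * (s `^ p)^-1 * (2 / (1 - `|x0|)) by eexists.
have sp0 : 0 < s `^ p by rewrite powR_gt0.
have K0 : 0 < K by rewrite KE !mulr_gt0// ?invr_gt0.
have point u : Q u -> cabs (f (u.1 +i* u.2)) <= s + K * G u.
  rewrite /Q prectP => -[hx hy]; have [_ phi] := near _ _ hx hy.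
  rewrite (le_trans (le_powR_shift p1 s0 (cabs_ge0 _)))// lerD2l.
  have -> : (cabs (f (u.1 +i* u.2)) / s) `^ p = cabs (f (u.1 +i* u.2)) `^ p * (s `^ p)^-1.
    rewrite powRM ?cabs_ge0 ?invr_ge0 ?(ltW s0)//.
    by rewrite -(powR_inv1 (ltW s0)) powRAC powR_inv1// powR_ge0.
  rewrite [leRHS](_ : _ = s * (cabs (f (u.1 +i* u.2)) `^ p * (s `^ p)^-1) *
    (2 / (1 - `|x0|) * phi_weight (u.1 +i* u.2))); last by rewrite KE /G; ring.
  rewrite ler_peMr//; first by rewrite !mulr_ge0 ?powR_ge0 ?invr_ge0// ltW.
  by rewrite mulrAC ler_pdivlMr// mul1r mulrC -ler_pdivrMr.
have area : ((r ^+ 2 / 16 * m)%:E <= (s * (4 * r ^+ 2) + K * (pi * W))%:E)%E.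
  apply: le_trans (area_estimate r0 _ mfQ) _.
    move=> x y hx hy; have [Dxy _] := near _ _ hx hy.
    by exists (@derive1 R[i] R[i]^o f (x +i* y)); exact: analytic_cder.
  apply: (@le_trans _ _ (\int[mu \x mu]_(u in Q) (s%:E + (K * G u)%:E))%E).
    apply: ge0_le_integral => //.
    - by move=> u ?; rewrite lee_fin cabs_ge0.
    - exact/measurable_EFinP.
    - apply: emeasurable_funD; first exact: measurable_cst.
      by apply/measurable_EFinP; apply: measurable_funM => //; exact: measurable_cst.
  rewrite ge0_integralD//.
  - rewrite EFinD leeD//.
      rewrite integral_cst// EFinM lee_pmul2l// le_eqVlt; apply/orP/or_introl/eqP.
      exact: measure_square.
    under eq_integral do rewrite EFinM.
    rewrite ge0_integralZl//; last 3 first.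
    + exact/measurable_EFinP.
    + by move=> u Qu; rewrite lee_fin; apply: GD0; exact: QD.
    + by rewrite lee_fin ltW.
    rewrite EFinM lee_pmul2l// -JE; apply: ge0_subset_integral => //.
    + exact/measurable_EFinP.
  - by move=> u _; rewrite lee_fin ltW.
  - by move=> u Qu; rewrite lee_fin mulr_ge0 ?(ltW K0)//; apply: GD0; exact: QD.
  - by apply/measurable_EFinP; apply: measurable_funM => //; exact: measurable_cst.
move: area; rewrite lee_fin.
have -> : m = 128 * s by rewrite sE; field.
have -> : r ^+ 2 / 16 * (128 * s) = s * (4 * r ^+ 2) + s * (4 * r ^+ 2) by field.
rewrite lerD2l => H.
(* The multiplier turns [K] into [8], and 16 r^2 = (1 - |z|)^2 gives the required left side. *)
have c0 : 0 <= 4 * s `^ p * (1 - `|x0|) / s by rewrite !mulr_ge0 ?invr_ge0// ltW.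
have := ler_wpM2r c0 H.
rewrite [leLHS](_ : _ = s `^ p * ((1 - cabs z) ^+ 2 * (1 - `|x0|))); last first.
  by rewrite /r; field; rewrite gt_eqF.
rewrite [leRHS](_ : _ = 8 * pi * W)//.
by rewrite KE; field; rewrite !gt_eqF.
Qed.

(** A p-th root of [point_evaluation_pow]; 128 stays outside the root because it divides |f z|
    before the power is taken. *)
Lemma point_evaluation_bound p f z : 1 <= p -> bergman_space phi_weight p f ->
  unit_disc z ->
  cabs (f z) <= 128 * (8 * pi) `^ p^-1 /
     ((1 - cabs z) `^ (2 / p) * (1 - `|complex.Re z|) `^ (1 / p))
     * bergman_norm phi_weight p f.
Proof.
move=> p1 Bf zD; have [W0 _] := disc_integral_fin p1 Bf.
have H := point_evaluation_pow p1 Bf zD.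
have zl : 0 < 1 - cabs z by rewrite subr_gt0.
have w0 : 0 < 1 - `|complex.Re z| by have := Re_le_cabs z; lra.
rewrite /bergman_norm; set W := fine _ in W0 H *.
have d0 : 0 < (1 - cabs z) ^+ 2 * (1 - `|complex.Re z|) by rewrite mulr_gt0// exprn_gt0.
have pi0 := pi_ge0 R.
move: H; rewrite -ler_pdivlMr// => /le_powR_root-/(_ p1 (divr_ge0 (cabs_ge0 _) (ler0n
    _ 128))).
rewrite ler_pdivrMr// => /le_trans; apply.
rewrite le_eqVlt; apply/orP/or_introl/eqP.
have pp : 0 <= 8 * pi :> R by rewrite mulr_ge0.
have ii : 0 <= ((1 - cabs z) ^+ 2 * (1 - `|complex.Re z|))^-1 by rewrite invr_ge0 ltW.
rewrite (powRM _ (mulr_ge0 pp W0) ii) (powRM _ pp W0).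
rewrite -(powR_inv1 (ltW d0)) powRAC powR_inv1 ?powR_ge0//.
rewrite (powRM _ (exprn_ge0 2 (ltW zl)) (ltW w0)).
by rewrite -(powR_mulrn 2 (ltW zl)) -powRrM mul1r; ring.
Qed.

End PointEvaluation.

(** * The complex exponential and the fundamental theorem of calculus *)

Section ComplexExponential.
Context {R : realType}.
Notation mu := (@lebesgue_measure R).
Implicit Types (a b c d e x y r s t M : R) (F G f : R[i] -> R[i]) (z w : R[i]).

Lemma is_derive_eps (g : R -> R) x d : is_derive x 1 g d <->
  forall e, 0 < e -> exists2 r, 0 < r & forall s, `|s - x| < r ->
    `|g s - g x - d * (s - x)| <= e * `|s - x|.
Proof.
have quot s e : s != x -> (`|d - (s - x)^-1 * (g s - g x)| <= e) =
    (`|g s - g x - d * (s - x)| <= e * `|s - x|).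
  move=> sx; have sx0 : s - x != 0 by rewrite subr_eq0.
  rewrite -[in RHS]normrN opprB.
  rewrite -(ler_pM2r (_ : 0 < `|s - x|)) ?normr_gt0// -normrM.
  by rewrite mulrBl mulrAC mulVf// mul1r.
split=> [[df dv] e e0|H].
  have /cvgrPdist_le /(_ e e0) : (h^-1 *: (g (h *: 1 + x) - g x)) @[h --> 0^'] --> d.
    by rewrite -dv; exact: df.
  rewrite near_withinE => /nbhs_ballP[r /= r0 rH].
  exists r => // s sx; have [->|nsx] := eqVneq s x.
    by rewrite !subrr mulr0 subrr normr0 mulr0.
  rewrite -quot//; have := rH (s - x).
  rewrite /ball /= sub0r normrN => /(_ sx); rewrite subr_eq0 => /(_ nsx).
  by rewrite /GRing.scale /= mulr1 subrK.
have cv : (h^-1 *: (g (h *: 1 + x) - g x)) @[h --> 0^'] --> d.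
  apply/cvgrPdist_le => e /H[r r0 rH].
  rewrite near_withinE; apply/nbhs_ballP; exists r => // h.
  rewrite /ball /= sub0r normrN => hr h0.
  have hx : h + x != x by rewrite -subr_eq0 addrK.
  have := rH (h + x); rewrite addrK => /(_ hr).
  by have := quot (h + x) e hx; rewrite addrK /GRing.scale /= mulr1 => ->.
by split; [apply/cvg_ex; exists d|apply: cvg_lim].
Qed.

Definition cexp w : R[i] := (expR (complex.Re w))%:C * (cos (complex.Im w) +i* sin
    (complex.Im w)).

Lemma cexpD z w : cexp (z + w) = cexp z * cexp w.
Proof.
case: z => a b; case: w => c d; rewrite /cexp /= expRD cosD sinD.
by apply: complexP; rewrite !(Re_mul, Im_mul) /=; ring.
Qed.

Lemma cexp0 : cexp 0 = 1.
Proof. by rewrite /cexp /= expR0 cos0 sin0 mul1r. Qed.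

Lemma cexp_nat n w : cexp (n%:R * w) = cexp w ^+ n.
Proof.
elim: n => [|n IH]; first by rewrite mul0r cexp0 expr0.
by rewrite -natr1 mulrDl mul1r cexpD IH exprSr.
Qed.

Lemma cabs_cexp w : cabs (cexp w) = expR (complex.Re w).
Proof.
rewrite /cexp cabsM cabs_real ger0_norm ?expR_ge0//.
by rewrite /ComplexField.Normc.normc cos2Dsin2 sqrtr1 mulr1.
Qed.

Lemma cexp_2pi x : cexp (x +i* (pi *+ 2)) = cexp (x +i* 0).
Proof. by rewrite /cexp /= cos2pi sin2pi cos0 sin0. Qed.

Lemma cder_cexp0 : cder cexp 0 1.
Proof.
apply/cderP => e e0.
(* The four error terms below are at most d|w|, 2d|w|, 4d|w| and d|w|, in total 8d|w|; [d <= 1]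
   ensures |x| <= 1. *)
have [d [d0 d1 d8]] : exists d, [/\ 0 < d, d <= 1 & d <= e / 8].
  exists (Num.min 1 (e / 8)); split; last by rewrite ge_min lexx orbT.
    by rewrite lt_min ltr01 divr_gt0.
  by rewrite ge_min lexx.
have [r1 r10 H1] := (is_derive_eps _ _ _).1 (@is_derive_expR R 0) d d0.
have [r2 r20 H2] := (is_derive_eps _ _ _).1 (@is_derive_cos R 0) d d0.
have [r3 r30 H3] := (is_derive_eps _ _ _).1 (@is_derive_sin R 0) d d0.
exists (Num.min d (Num.min r1 (Num.min r2 r3))); first by rewrite !lt_min d0 r10 r20.
case=> x y; rewrite cexp0 !subr0 mul1r !lt_min => /and4P[wd w1 w2 w3].
set w := x +i* y in wd w1 w2 w3 *.
have xw : `|x| <= cabs w by exact: (Re_le_cabs w).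
have yw : `|y| <= cabs w by exact: (Im_le_cabs w).
have {H1} := H1 x; rewrite subr0 expR0 mul1r => /(_ (le_lt_trans xw w1)) H1.
have {H2} := H2 y; rewrite subr0 cos0 sin0 oppr0 mul0r subr0 => /(_ (le_lt_trans yw
    w2)) H2.
have {H3} := H3 y; rewrite subr0 cos0 sin0 subr0 mul1r => /(_ (le_lt_trans yw w3)) H3.
have x1 : `|x| <= 1 by rewrite (le_trans xw)// (le_trans (ltW wd)).
have ex : `|expR x - 1| <= 2 * `|x|.
  rewrite (_ : _ - 1 = (expR x - 1 - x) + x); last by ring.
  rewrite (le_trans (ler_normD _ _))// mulr_natl mulr2n lerD2r (le_trans H1)//.
  by rewrite ler_piMl.
have sy : `|sin y| <= 2 * `|y|.
  rewrite (_ : sin y = (sin y - y) + y); last by ring.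
  rewrite (le_trans (ler_normD _ _))// mulr_natl mulr2n lerD2r (le_trans H3)//.
  by rewrite ler_piMl.
have rep : complex.Re (cexp w - 1 - w) = (expR x - 1 - x) * cos y + (1 + x) * (cos y - 1).
  by rewrite !(ReD, ReN) /cexp /=; ring.
have imp : complex.Im (cexp w - 1 - w) = (expR x - 1) * sin y + (sin y - y).
  by rewrite !(ImD, ImN) /cexp /=; ring.
rewrite (le_trans (cabs_le_ReIm _))// rep imp.
have cy : `|cos y| <= 1 by rewrite ler_norml cos_geN1 cos_le1.
have W0 := cabs_ge0 w.
have A : `|(expR x - 1 - x) * cos y| <= d * cabs w.
  rewrite normrM -[leRHS]mulr1 ler_pM// (le_trans H1)// ler_wpM2l// ltW//.
have B : `|(1 + x) * (cos y - 1)| <= 2 * (d * cabs w).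
  rewrite normrM ler_pM//; last by rewrite (le_trans H2)// ler_wpM2l// ltW.
  by rewrite (le_trans (ler_normD _ _))// normr1; lra.
(* A product of two first order terms, made small by |x| <= d and |y| <= |w|. *)
have D : `|(expR x - 1) * sin y| <= 4 * (d * cabs w).
  rewrite normrM (le_trans (ler_pM _ _ ex sy))//.
  rewrite mulrACA -natrM ler_pM2l// ler_pM//; lra.
have E : `|sin y - y| <= d * cabs w by rewrite (le_trans H3)// ler_wpM2l// ltW.
have F := ler_wpM2r W0 d8.
have := ler_normD ((expR x - 1 - x) * cos y) ((1 + x) * (cos y - 1)).
have := ler_normD ((expR x - 1) * sin y) (sin y - y).
lra.
Qed.

Lemma cder_cexp z : cder cexp z (cexp z).
Proof.
have -> : cexp = fun w => cexp z * cexp (w - z).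
  by apply/funext => w; rewrite -cexpD addrC subrK.
rewrite subrr cexp0 mulr1 -[X in cder _ _ X]mulr1; apply: cderZ.
rewrite -[X in cder _ _ X](mulr1 1); apply: cder_comp.
  by rewrite -[X in cder _ _ X]subr0; apply: cderB; [exact: cder_id|exact: cder_cst].
by rewrite subrr; exact: cder_cexp0.
Qed.

Lemma vseg_FTC F (F' : R[i] -> R[i]) x0 a b : a < b ->
  (forall y, a <= y <= b -> cder F (x0 +i* y) (F' (x0 +i* y))) ->
  (forall y, a <= y <= b -> ccont F' (x0 +i* y)) ->
  (0 +i* 1) * vseg F' x0 a b = F (x0 +i* b) - F (x0 +i* a).
Proof.
move=> ab dF cF'.
have cc := vcurve cF'.
rewrite /vseg -cintZ; last exact: ccurve_cintegrable.
have cF y : a <= y <= b -> ccurve (fun y => F (x0 +i* y)) y.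
  by move=> yab; apply: (@vcurve _ F x0 a b) => // t tab; apply: cder_cont; exact: dF.
(* [h] stands for [complex.Re] or [complex.Im]: additive, homogeneous over the reals and bounded by
   the modulus, so it carries the complex derivative along the segment to a real derivative. *)
have part (h : R[i] -> R) : (forall z w, h (z - w) = h z - h w) ->
    (forall x z, h (x%:C * z) = x * h z) -> (forall z, `|h z| <= cabs z) ->
    \int[mu]_(t in `[a, b]) h ((0 +i* 1) * F' (x0 +i* t)) = h (F (x0 +i* b)) - h (F
        (x0 +i* a)).
  move=> hB hZ hn.
  have lip z w : `|h z - h w| <= cabs (z - w) by rewrite -hB.
  have cont y : a <= y <= b -> {for y, continuous (fun t => h (F (x0 +i* t)))}.
    by move=> /cF; exact: ccurve_continuous.
  have der y : a <= y <= b ->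
      is_derive y 1 (fun t => h (F (x0 +i* t))) (h ((0 +i* 1) * F' (x0 +i* y))).
    move=> yab; apply/is_derive_eps => e e0.
    have [r r0 Fr] := (cderP _ _ _).1 (dF _ yab) e e0.
    exists r => // s sy.
    have dist : (x0 +i* s) - (x0 +i* y) = (s - y)%:C * (0 +i* 1).
      by apply: complexP; rewrite !(ReD, ImD, ReN, ImN, Re_mul, Im_mul) /=; ring.
    have dn : cabs ((x0 +i* s) - (x0 +i* y)) = `|s - y|.
      by rewrite dist cabsM cabs_real cabs_imag normr1 mulr1.
    have := Fr (x0 +i* s); rewrite dn => /(_ sy); apply: le_trans.
    rewrite [X in `|X|](_ : _ = h (F (x0 +i* s) - F (x0 +i* y) -
      F' (x0 +i* y) * ((x0 +i* s) - (x0 +i* y)))); first exact: hn.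
    by rewrite dist mulrCA !hB hZ [F' _ * _]mulrC [X in _ - X]mulrC.
  have [cFa cFb] : {for a, continuous (fun t => h (F (x0 +i* t)))} /\ {for b,
      continuous (fun t => h (F (x0 +i* t)))}.
    by split; apply: cont; rewrite lexx ltW.
  have := @continuous_FTC2 R (fun t => h ((0 +i* 1) * F' (x0 +i* t))) (fun t => h (F
      (x0 +i* t))) a b ab.
  move=> E; rewrite /Rintegral E//.
  - apply: ccurve_within lip _ => y yab e e0; have [r r0 gr] := cc _ yab _ e0.
    exists r => // s sy; rewrite -mulrBr cabsM cabs_imag normr1 mul1r; exact: gr.
  - split; [|exact: cvg_at_right_filter|exact: cvg_at_left_filter].
    move=> y; rewrite in_itv /= => /andP[ay yb].
    by have [] := der y ltac:(by rewrite !ltW).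
  - move=> y; rewrite in_itv /= => /andP[ay yb]; rewrite derive1E.
    by have [_ ->] := der y ltac:(by rewrite !ltW).
apply: complexP; rewrite ?ReD ?ImD ?ReN ?ImN; apply: part => [z w|x z|z].
- by rewrite ReD ReN.
- by rewrite Re_mul /= mul0r subr0.
- exact: Re_le_cabs.
- by rewrite ImD ImN.
- by rewrite Im_mul /= mul0r addr0.
- exact: Im_le_cabs.
Qed.

End ComplexExponential.

(** * Taylor coefficients as Fourier coefficients *)

Section TaylorCoefficients.
Context {R : realType}.
Notation mu := (@lebesgue_measure R).
Implicit Types (a b c d e x y r s t M : R) (F G f : R[i] -> R[i]) (z w : R[i]).

Lemma cder_derivable f z (d : R[i]) : cder f z d -> @derivable R[i] R[i]^o R[i]^o f z 1.
Proof.
move=> /cder_cvg H; rewrite /derivable.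
rewrite (_ : (fun h => _) = (fun h : R[i] => h^-1 * (f (h + z) - f z))).
  by apply/cvg_ex; exists d.
by apply/funext => h; rewrite /GRing.scale /= mulr1.
Qed.

Lemma analytic_derive1 f : analytic_on_disc f ->
  analytic_on_disc (@derive1 R[i] R[i]^o f).
Proof. by move=> af z /(cder_derive1 af)[D]; exact: cder_derivable. Qed.

Lemma unit_disc0 : unit_disc (0 : R[i]).
Proof. by rewrite /unit_disc /= ComplexField.Normc.normc0. Qed.

Lemma pi2_gt0 : 0 < pi *+ 2 :> R.
Proof. by rewrite mulrn_wgt0// pi_gt0. Qed.

(* The n-th Fourier coefficient of f on the circle of radius r, up to the
   factor 2 pi: with z = r e^w, the circle is a vertical segment. *)
Definition circle_coef f r (n : nat) : R[i] :=
  vseg (fun w => f (r%:C * cexp w) * cexp (- n%:R * w)) 0 0 (pi *+ 2).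

(** All contours in the logarithmic coordinate lie in the closed left half plane, which w -> r e^w
    maps into the disc. *)
Lemma circle_disc r w : 0 < r < 1 -> complex.Re w <= 0 -> unit_disc (r%:C * cexp w).
Proof.
move=> /andP[r0 r1] w0; rewrite /unit_disc /= cabsM cabs_real cabs_cexp gtr0_norm//.
by rewrite (le_lt_trans _ r1)// ler_piMr// ?(ltW r0)// -expR0 ler_expR.
Qed.

Lemma cder_circle f r w : 0 < r < 1 -> complex.Re w <= 0 -> analytic_on_disc f ->
  cder (fun w => f (r%:C * cexp w)) w
    (@derive1 R[i] R[i]^o f (r%:C * cexp w) * (r%:C * cexp w)).
Proof.
move=> r01 w0 af; apply: cder_comp; first by apply: cderZ; exact: cder_cexp.
by apply: analytic_cder => //; exact: circle_disc.
Qed.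

Lemma cder_cexp_nat n w : cder (fun w => cexp (- n%:R * w)) w (cexp (- n%:R * w) * -
    n%:R).
Proof.
apply: cder_comp; last exact: cder_cexp.
by rewrite -[X in cder _ _ X]mulr1; apply: cderZ; exact: cder_id.
Qed.

(** On the rectangle [s, 0] x [0, 2 pi] the horizontal sides cancel by periodicity, so the mean over
    the circle of radius r e^s is the same for all s <= 0; for s very negative, f is nearly f(0) on
    that circle. *)
Lemma circle_coef0 f r : 0 < r < 1 -> analytic_on_disc f -> circle_coef f r 0 = (pi
    *+ 2)%:C * f 0.
Proof.
move=> r01 af; have [r0 r1] := andP r01.
pose G w := f (r%:C * cexp w).
have -> : circle_coef f r 0 = vseg G 0 0 (pi *+ 2).
  by congr vseg; apply/funext => w; rewrite oppr0 mul0r cexp0 mulr1.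
have cG w : complex.Re w <= 0 -> ccont G w.
  by move=> w0; apply: cder_cont; exact: cder_circle.
have shift s : s <= 0 -> vseg G 0 0 (pi *+ 2) = vseg G s 0 (pi *+ 2).
  move=> s0; have := @goursat _ G s 0 0 (pi *+ 2) s0 (ltW pi2_gt0) _.
  rewrite /rint; have -> : hseg G s 0 0 = hseg G s 0 (pi *+ 2).
    by apply: eq_cint => x _; rewrite /G cexp_2pi.
  rewrite subrr add0r => H; apply/eqP; rewrite -subr_eq0; apply/eqP.
  have i0 : (0 +i* 1 : R[i]) != 0 by rewrite eq_complex /= oner_eq0 andbF.
  apply: (mulfI i0); rewrite mulr0; apply: H.
  by move=> x y /andP[_ x0] _; eexists; apply: cder_circle.
apply/eqP; rewrite -subr_eq0 -cabs_eq0 eq_le cabs_ge0 andbT; apply/ler_addgt0Pl => e e0.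
rewrite addr0.
have e1 : 0 < e / (pi *+ 2) by rewrite divr_gt0// pi2_gt0.
have [d d0 fd] := cder_cont (analytic_cder af unit_disc0) e1.
(* Chosen so that r e^s < d, where [f] is within the tolerance of [f 0]; the minimum with [0] keeps
   the contour in the left half plane. *)
pose s := Num.min 0 (ln (d / 2)).
have s0 : s <= 0 by rewrite ge_min lexx.
have sd : r * expR s < d.
  have : expR s <= d / 2.
    have -> : d / 2 = expR (ln (d / 2)) by rewrite lnK// posrE divr_gt0.
    by rewrite ler_expR ge_min lexx orbT.
  have : r * expR s <= expR s by rewrite ler_piMl ?expR_ge0// ltW.
  by move: d0; lra.
have ccs y : ccurve (fun y => G (s +i* y)) y.
  by apply: (@vcurve _ G s y y) => [t _|]; [exact: cG|rewrite lexx].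
have -> : (pi *+ 2)%:C * f 0 = cint 0 (pi *+ 2) (fun=> f 0).
  by rewrite cint_cst ?subr0// ltW// pi2_gt0.
rewrite (shift s s0) /vseg.
have cst0 y : ccurve (fun=> f 0) y.
  by move=> e' e'0; exists 1 => // t _; rewrite subrr ComplexField.Normc.normc0 ltW.
rewrite -cintB; [|by apply: ccurve_cintegrable|by apply: ccurve_cintegrable].
have -> : e = e / (pi *+ 2) * (pi *+ 2 - 0) by rewrite subr0 divfK// gt_eqF// pi2_gt0.
apply: cint_le; first exact/ltW/pi2_gt0.
  move=> t _ e' e'0; have [r' r'0 Gr] := ccs t _ e'0; exists r' => // u ut.
  by rewrite opprB addrA subrK; exact: Gr.
move=> t _; apply: fd; rewrite subr0 cabsM cabs_real cabs_cexp /= gtr0_norm//.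
Qed.

(** The function [K], that is f(r e^w) e^(-(n+1)w), takes equal values at 0 and 2 pi i, so its
    derivative, the difference of the two integrands, integrates to zero. *)
Lemma circle_coefS f r n : 0 < r < 1 -> analytic_on_disc f ->
  r%:C * circle_coef (@derive1 R[i] R[i]^o f) r n = n.+1%:R * circle_coef f r n.+1.
Proof.
move=> r01 af; set f' := @derive1 R[i] R[i]^o f.
have af' := analytic_derive1 af.
pose K w := f (r%:C * cexp w) * cexp (- n.+1%:R * w).
pose K1 w := f' (r%:C * cexp w) * cexp (- n%:R * w).
pose K' w := r%:C * K1 w - n.+1%:R * K w.
have dK w : complex.Re w <= 0 -> cder K w (K' w).
  move=> w0; have := cderM (cder_circle r01 w0 af) (cder_cexp_nat n.+1 w).
  congr cder; rewrite /K' /K1 /K -/f'.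
  have -> : cexp (- n%:R * w) = cexp w * cexp (- n.+1%:R * w).
    by rewrite -cexpD; congr cexp; rewrite -natr1; ring.
  ring.
have cK w : complex.Re w <= 0 -> ccont K w by move=> /dK/cder_cont.
have cK1 w : complex.Re w <= 0 -> ccont K1 w.
  move=> w0; apply: ccontM; apply: cder_cont; first exact: (cder_circle r01 w0 af').
  exact: cder_cexp_nat.
have cK' w : complex.Re w <= 0 -> ccont K' w.
  move=> w0; rewrite (_ : K' = fun w => r%:C * K1 w + (- n.+1%:R) * K w).
    by apply: ccontD; apply: ccontM; [exact: ccont_cst|exact: cK1|exact:
        ccont_cst|exact: cK].
  by apply/funext => u; rewrite mulNr.
have re0 y : complex.Re (0 +i* y) <= 0 by rewrite /=.
have := @vseg_FTC _ K K' 0 0 (pi *+ 2) pi2_gt0 (fun y _ => dK _ (re0 y)) (fun y _ =>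
    cK' _ (re0 y)).
have -> : K (0 +i* (pi *+ 2)) = K (0 +i* 0).
  rewrite /K cexp_2pi; congr (_ * _).
  by rewrite !mulNr -!mulrN !cexp_nat /cexp /= !oppr0 cosN sinN cos2pi sin2pi cos0
      sin0 oppr0.
rewrite subrr => /eqP; rewrite mulf_eq0 eq_complex /= oner_eq0 andbF /= => /eqP.
rewrite /vseg cintB; last 2 first.
- apply/cintegrableZ/ccurve_cintegrable; apply: vcurve => y _; exact/cK1/re0.
- apply/cintegrableZ/ccurve_cintegrable; apply: vcurve => y _; exact/cK/re0.
rewrite !cintZ; last 2 first.
- apply/ccurve_cintegrable; apply: vcurve => y _; exact/cK/re0.
- apply/ccurve_cintegrable; apply: vcurve => y _; exact/cK1/re0.
by move=> /eqP; rewrite subr_eq0 => /eqP.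
Qed.

(** [derive1Sn] differentiates [f] first, so the induction runs over all analytic [f] and is applied
    to f', analytic by [analytic_derive1]. *)
Lemma circle_coef_cderiven n f r : 0 < r < 1 -> analytic_on_disc f ->
  (pi *+ 2)%:C * (r%:C ^+ n * cderiven n f 0) = n`!%:R * circle_coef f r n.
Proof.
move=> r01; elim: n f => [|n IH] f af.
  by rewrite expr0 !mul1r circle_coef0.
rewrite /cderiven derive1Sn -/(cderiven n _) exprS -!mulrA mulrCA IH;
    last exact: analytic_derive1.
by rewrite mulrCA circle_coefS// factS natrM; ring.
Qed.

(** Since e^(-int) has modulus 1, the coefficient is at most 2 pi M, and 2 pi cancels in
    [circle_coef_cderiven]. *)
Lemma cauchy_estimate n f r M : 0 < r < 1 -> analytic_on_disc f ->
  (forall z, cabs z = r -> cabs (f z) <= M) ->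
  cabs (cderiven n f 0) / n`!%:R <= M / r ^+ n.
Proof.
move=> r01 af fM; have [r0 r1] := andP r01.
have rn : 0 < r ^+ n by rewrite exprn_gt0.
have nf : 0 < n`!%:R :> R by rewrite ltr0n fact_gt0.
have cn : cabs (n`!%:R : R[i]) = n`!%:R.
  by rewrite -(rmorph_nat (real_complex R)) cabs_real normr_nat.
have re0 y : complex.Re (0 +i* y) <= 0 by rewrite /=.
have bound : cabs (circle_coef f r n) <= M * (pi *+ 2 - 0).
  apply: cint_le; first exact/ltW/pi2_gt0.
    move=> t _; apply: (@vcurve _ (fun w => f (r%:C * cexp w) * cexp (- n%:R * w)) 0
        t t) => [y _|]; last by rewrite lexx.
    apply: ccontM; apply: cder_cont; first exact: (cder_circle r01 (re0 y) af).
    exact: cder_cexp_nat.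
  move=> t _; rewrite cabsM cabs_cexp.
  have -> : complex.Re (- n%:R * (0 +i* t)) = 0.
    by rewrite -(rmorph_nat (real_complex R)) Re_mul /=; ring.
  by rewrite expR0 mulr1 fM// cabsM cabs_real cabs_cexp /= expR0 mulr1 gtr0_norm.
have := circle_coef_cderiven n r01 af => /(congr1 (fun z => cabs z)).
rewrite !cabsM cabsX !cabs_real cn (gtr0_norm r0) (gtr0_norm pi2_gt0) => E.
rewrite ler_pdivrMr// mulrAC ler_pdivlMr// -(ler_pM2l pi2_gt0) [_ * r ^+ n]mulrC E.
rewrite mulrC [leRHS](_ : _ = M * (pi *+ 2 - 0) * n`!%:R); last by rewrite subr0; ring.
by rewrite ler_wpM2r// ltW.
Qed.

End TaylorCoefficients.

(** * Growth of the Taylor coefficients, part (ii) *)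

Section CoefficientBound.
Context {R : realType}.
Implicit Types (f : R[i] -> R[i]) (z : R[i]) (p : R).

(** The inverse is (1 + 1/(n+1))^n, and 1 + x <= e^x bounds it by e^(n/(n+1)). *)
Lemma inv_exp_le_e n : ((n.+1%:R / n.+2%:R) ^+ n)^-1 <= expR 1 :> R.
Proof.
rewrite -exprVn invf_div (_ : n.+2%:R / n.+1%:R = 1 + n.+1%:R^-1 :> R); last first.
  by rewrite -[n.+2%:R]natr1 mulrDl mul1r divff// pnatr_eq0.
have le1 : (1 + n.+1%:R^-1) ^+ n <= (expR n.+1%:R^-1) ^+ n :> R.
  by rewrite lerXn2r ?nnegrE ?expR_ge0 ?addr_ge0 ?expR_ge1Dx.
rewrite (le_trans le1)// -expRM_natl ler_expR ler_pdivrMr ?ltr0n// mul1r ler_nat.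
exact: leqnSn.
Qed.

(** Here 1 - |z| = 1/(n+2), and |Re z| <= |z| makes the weight at least as large, so the exponents
    2/p and 1/p add up; then n + 2 <= 2 (n + 1) costs the factor 2^(3/p). *)
Lemma circle_bound p f n z : 1 <= p -> bergman_space phi_weight p f ->
  cabs z = n.+1%:R / n.+2%:R ->
  cabs (f z) <= 128 * (8 * pi) `^ p^-1 * (2 `^ (3 / p) * n.+1%:R `^ (3 / p))
    * bergman_norm phi_weight p f.
Proof.
move=> p1 Bf zr.
have N0 : 0 < n.+2%:R :> R by rewrite ltr0n.
have zl : 1 - cabs z = n.+2%:R^-1.
  by rewrite zr -{1}(divff (lt0r_neq0 N0)) -mulrBl -natrB// subSnn mul1r.
have zD : unit_disc z by rewrite /unit_disc /= -subr_gt0 zl invr_gt0.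
have p0 : 0 < p by rewrite (lt_le_trans ltr01).
apply: le_trans (point_evaluation_bound p1 Bf zD) _.
rewrite ler_wpM2r ?powR_ge0// ler_wpM2l ?mulr_ge0 ?powR_ge0//.
have wl : n.+2%:R^-1 <= 1 - `|complex.Re z| by rewrite -zl lerD2l lerN2 Re_le_cabs.
have d0 : 0 < (1 - cabs z) `^ (3 / p) by rewrite powR_gt0// zl invr_gt0.
apply: (@le_trans _ _ ((1 - cabs z) `^ (3 / p))^-1).
  rewrite lef_pV2 ?posrE//; last first.
    rewrite mulr_gt0// powR_gt0//; first by rewrite zl invr_gt0.
    by rewrite (lt_le_trans _ wl)// invr_gt0.
  rewrite (_ : 3 / p = 2 / p + 1 / p); last by field; rewrite gt_eqF.
  rewrite powRD; last by apply/implyP => _; rewrite zl invr_neq0// gt_eqF.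
  rewrite ler_wpM2l ?powR_ge0// ge0_ler_powR ?divr_ge0 ?(ltW p0)//.
  - by rewrite nnegrE zl invr_ge0 ltW.
  - by rewrite nnegrE (le_trans _ wl)// invr_ge0 ltW.
  - by rewrite zl.
rewrite zl -powRM// -powRN -(powR_inv1 (ltW N0)) -powRrM mulN1r opprK.
rewrite ge0_ler_powR ?divr_ge0 ?(ltW p0) ?nnegrE ?(ltW N0) ?mulr_ge0//.
by rewrite -natrM ler_nat; lia.
Qed.

End CoefficientBound.

Theorem proposition2p4 (R : realType) (p : R) (hp : 1 <= p) :
  (exists C : R, 0 < C /\
    forall f : R[i] -> R[i], bergman_space phi_weight p f ->
    forall z : R[i], unit_disc z ->
      cabs (f z) <=
        C / ((1 - cabs z) `^ (2 / p) * (1 - `|complex.Re z|) `^ (1 / p))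
        * bergman_norm phi_weight p f)
  /\
  (exists C' : R, 0 < C' /\
    forall f : R[i] -> R[i], bergman_space phi_weight p f ->
    forall n : nat,
      cabs (cderiven n f 0) / (n`!)%:R <=
        C' * (n.+1)%:R `^ (3 / p) * bergman_norm phi_weight p f).
Proof.
have C0 : 0 < 128 * (8 * pi) `^ p^-1 :> R.
  by rewrite mulr_gt0// powR_gt0// mulr_gt0// pi_gt0.
split.
  exists (128 * (8 * pi) `^ p^-1); split=> // f Bf z zD.
  exact: point_evaluation_bound.
exists (128 * (8 * pi) `^ p^-1 * 2 `^ (3 / p) * expR 1); split.
  by rewrite mulr_gt0 ?expR_gt0// mulr_gt0// powR_gt0.
move=> f Bf n; have [af _] := Bf.
(* The shift from n / (n + 1) to (n + 1) / (n + 2) keeps the radius positive for n = 0. *)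
have r01 : 0 < (n.+1%:R : R) / n.+2%:R < 1.
  apply/andP; split; first by rewrite divr_gt0.
  by rewrite ltr_pdivrMr// mul1r ltr_nat.
apply: le_trans (cauchy_estimate n r01 af (fun z => circle_bound hp Bf)) _.
rewrite [leRHS](_ : _ = 128 * (8 * pi) `^ p^-1 * (2 `^ (3 / p) * n.+1%:R `^ (3 / p))
    * bergman_norm phi_weight p f * expR 1); last by ring.
rewrite ler_wpM2l ?inv_exp_le_e//.
by rewrite !mulr_ge0 ?powR_ge0// ltW.
Qed.
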